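(* Let $G$ be a finite group of order $n$. For each prime $p$ dividing $n$, let $G_p$ be a Sylow $p$-subgroup of $G$, of order $p^{n_p}$, and put $d_p=d(G_p)$, $\delta_p=d(G_p/Z(G_p))$, $k'_p=d(\gamma_2G_p/\gamma_3G_p)$, $|\gamma_2G_p|=p^{k_p}$; let $r_p,t_p$ be non-negative integers with $\binom{\delta_p}{2}-k'_p=\binom{r_p}{2}+t_p$ and $0\le t_p<r_p$. Then \[|M(G)|\le\prod_{p\mid n}p^{\frac{1}{2}(d_p-1)(n_p+k_p)-k_p(d_p-\delta_p)-\binom{\delta_p}{3}+\binom{r_p}{3}+\binom{t_p}{2}},\] where the product runs over all primes $p$ dividing $n$.
   Context: $d(H)$ denotes the minimal number of generators of a finite group $H$; $Z(H)$ is the center; $\gamma_iH$ is the $i$-th term of the lower central series; $M(G)$ is the Schur multiplier of $G$. Binomial coefficients satisfy $\binom{a}{b}=0$ when $0\le a<b$. *)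

(* Defs.v *)
From HB Require Import structures.
From mathcomp Require Import all_boot all_order all_algebra all_fingroup all_solvable all_field.
Set Implicit Arguments.
Unset Strict Implicit.
Unset Printing Implicit Defensive.
Import GRing.Theory Num.Theory.
Local Open Scope group_scope.

(* Schur multiplier M(G) = H^2(G, C^x) (trivial action), with the algebraically
   closed field algC of algebraic complex numbers as coefficient field. *)
Definition mult_cocycle (gT : finGroupType) (G : {set gT})
    (f : gT -> gT -> algC) : Prop :=
  (forall x y, x \in G -> y \in G -> f x y != 0%R) /\
  (forall x y z, x \in G -> y \in G -> z \in G ->
     (f x y * f (x * y)%g z = f y z * f x (y * z)%g)%R).

Definition cohomologous (gT : finGroupType) (G : {set gT})
    (f1 f2 : gT -> gT -> algC) : Prop :=
  exists g : gT -> algC, (forall x, x \in G -> g x != 0%R) /\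
    (forall x y, x \in G -> y \in G ->
       f1 x y = (f2 x y * (g x * g y / g (x * y)%g))%R).

(* schur_mult_le G m  <->  |M(G)| <= m, i.e. the cohomology classes of
   2-cocycles of G with values in algC^x can be covered by m representatives. *)
Definition schur_mult_le (gT : finGroupType) (G : {set gT}) (m : nat) : Prop :=
  exists h : 'I_m -> gT -> gT -> algC,
    forall f, mult_cocycle G f -> exists i : 'I_m, cohomologous G f (h i).

(* Main.v *)
(** For a cocycle [f] and commuting [x], [y], the commutator of their lifts to
    the central extension defined by [f] is the scalar [f x y / f y x], which is
    bimultiplicative.  For N central in G, a class whose pairing is trivial on
    N x G is inflated from G / N, and if N lies in G' then each inflated class
    comes from exactly |N| classes of G / N; hence |M(G)| |N| is at most |M(G / N)|
    times the number of possible pairings.  For a p-group P this is applied first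
    to central subgroups of order p, going down to H = P / (gamma_3 Phi(gamma_2));
    since the pairing of gamma_2 with Z(P) is trivial, each of them has at most
    p^delta pairings.  It is then applied to N = H', where the Hall-Witt identity
    imposes one linear relation on the pairing for each triple of generators.  The
    relations of the triples having a pair in a greedy basis of H' are
    independent; the remaining triples are the triangles of a graph with
    C(delta,2) - dim H' edges, which are counted by Kruskal-Katona.  The abelian
    group H / H' is bounded by its alternating bicharacters, and the passage from
    G to its Sylow subgroups is by transfer. *)
Require Import Defs.
From HB Require Import structures.
From mathcomp Require Import all_boot all_order all_algebra all_fingroup all_solvable all_field.
From mathcomp Require Import ring zify spectral classfun character.
From Stdlib Require Import Classical.
Set Implicit Arguments.
Unset Strict Implicit.
Unset Printing Implicit Defensive.

(** * Triangles in graphs and codes of finite sets *)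
(** Convexity: with [a = x + k] and [y = b + k], raising [k] by one adds [x + k] on the left and
    [b + k] on the right. *)
Lemma bin2_convex a b x y :
  a + b = x + y -> x <= a -> x <= b -> 'C(a, 2) + 'C(b, 2) <= 'C(x, 2) + 'C(y, 2).
Proof.
move=> e xa xb.
have [k ak] : exists k, a = x + k by exists (a - x); lia.
have bk : y = b + k by lia.
rewrite {}ak {}bk {e xa y} in xb *.
elim: k => [|k IH]; first by rewrite !addn0.
rewrite !addnS !binS !bin1; lia.
Qed.

Section Triangles.
Variable T : finType.
Implicit Types (E : {set {set T}}) (v : T) (D : {set T}).

Definition triangles E : {set {set T}} :=
  [set D : {set T} | (#|D| == 3) && [forall x in D, D :\ x \in E]].

Let star E v := [set e in E | v \in e].
Let nbr E v := [set x | (x != v) && ([set v; x] \in E)].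

Lemma card_star E v : (forall e, e \in E -> #|e| = 2) -> #|star E v| = #|nbr E v|.
Proof.
move=> E2; have inj : {in nbr E v &, injective (fun x => [set v; x])}.
  move=> x y; rewrite !inE => /andP[xv _] /andP[yv _] /setP/(_ x).
  by rewrite !inE eqxx orbT (negPf xv) /= => /esym/eqP.
rewrite -(card_in_imset inj); apply: eq_card => e; apply/idP/imsetP.
  rewrite inE => /andP[Ee ve]; have /cards2P[x [y [xy eE]]] : #|e| == 2 by rewrite E2.
  move: ve Ee; rewrite eE !inE => /orP[]/eqP-> Ee.
    by exists y; rewrite // inE eq_sym xy.
  by exists x; last rewrite setUC //; rewrite inE xy setUC.
by case=> x; rewrite !inE => /andP[_ Ex] ->; rewrite Ex !inE eqxx.
Qed.

Lemma handshake E : (forall e, e \in E -> #|e| = 2) ->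
  \sum_v #|nbr E v| = 2 * #|E|.
Proof.
move=> E2; rewrite mulnC -sum_nat_const.
transitivity (\sum_v \sum_(e in E) (v \in e : nat)).
  apply: eq_bigr => v _; rewrite -card_star // -sum1_card big_mkcond /=.
  rewrite [RHS]big_mkcond /=; apply: eq_bigr => e _; rewrite inE.
  by case: (e \in E); case: (v \in e).
rewrite exchange_big /=; apply: eq_bigr => e Ee; rewrite -(E2 e Ee) -sum1_card.
by rewrite [RHS]big_mkcond.
Qed.

(* Kruskal-Katona for graphs, by deleting a vertex of degree between 1 and r - 1. *)
Lemma card_triangles E r t : (forall e, e \in E -> #|e| = 2) ->
  t < r -> #|E| <= 'C(r, 2) + t -> #|triangles E| <= 'C(r, 3) + 'C(t, 2).
Proof.
have [m] := ubnP #|E|; elim: m => // m IH in E r t *.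
rewrite ltnS => leE E2 tr Er.
have [E0|[e0 Ee0]] := set_0Vmem E.
  suff -> : triangles E = set0 by rewrite cards0.
  apply/setP=> D; rewrite !inE; apply/negP=> /andP[/eqP D3 /forallP H].
  have /card_gt0P[x Dx] : 0 < #|D| by rewrite D3.
  by have := H x; rewrite Dx E0 inE.
(* Otherwise an endpoint [x] of [e0] and its neighbours are at least [r + 1] vertices of degree at
   least [r], so [2 * #|E| >= r * (r + 1)], which exceeds [r * (r - 1) + 2 * t] because [t < r]. *)
have [v /andP[dv1 dvr]] : exists v, 0 < #|nbr E v| < r.
  apply/existsP; apply: contraT; rewrite negb_exists => /forallP nv.
  have bigv v : 0 < #|nbr E v| -> r <= #|nbr E v|.
    by move=> dv; have := nv v; rewrite dv /= -leqNgt.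
  have /cards2P[x [y [xy eE]]] : #|e0| == 2 by rewrite E2.
  have nx : y \in nbr E x by rewrite inE eq_sym xy -eE.
  have dx : r <= #|nbr E x| by apply: bigv; apply/card_gt0P; exists y.
  have dn z : z \in x |: nbr E x -> r <= #|nbr E z|.
    rewrite in_setU1 => /predU1P[->//|nz]; apply: bigv; apply/card_gt0P.
    by exists x; move: nz; rewrite !inE eq_sym setUC.
  have : \sum_(z in x |: nbr E x) r <= 2 * #|E|.
    rewrite -handshake // [X in _ <= X](bigID (fun z => z \in x |: nbr E x)) /=.
    by apply: leq_trans (leq_addr _ _); apply: leq_sum.
  rewrite sum_nat_const cardsU1 inE eqxx /= add1n.
  have : 2 * 'C(r, 2) = r * r.-1 by rewrite -mul_bin_diag bin1.
  have : r.+1 * r <= (#|nbr E x|).+1 * r by rewrite leq_mul.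
  move: #|nbr E x|.+1 => k; case: (r) tr Er => // r' /= *; nia.
pose d := #|nbr E v|; pose E' := E :\: star E v.
have sE : star E v \subset E by apply/subsetP=> e; rewrite inE => /andP[].
have cE' : #|E'| + d = #|E|.
  rewrite /d -card_star // cardsD (setIidPr sE) subnK //; exact: subset_leq_card.
have E'2 e : e \in E' -> #|e| = 2 by rewrite inE => /andP[_ /E2].
(* Deleting [v] sends these triangles injectively to pairs of neighbours of [v]. *)
have through_v : #|[set D in triangles E | v \in D]| <= 'C(d, 2).
  have inj : {in [set D in triangles E | v \in D] &, injective (fun D => D :\ v)}.
    move=> D1 D2; rewrite !inE => /andP[_ v1] /andP[_ v2] e.
    by rewrite -(setD1K v1) -(setD1K v2) e.
  rewrite -cards_draws -(card_in_imset inj).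
  apply/subset_leq_card/subsetP => B /imsetP[D]; rewrite !inE => /andP[/andP[/eqP D3 /forallP DE] vD] ->.
  have B2 : #|D :\ v| = 2 by have := cardsD1 v D; rewrite vD D3; lia.
  rewrite B2 eqxx andbT; apply/subsetP=> x Bx.
  have := Bx; rewrite !inE => /andP[xv Dx]; rewrite xv /=.
  have /cards1P[y By] : #|D :\ v :\ x| == 1.
    by have := cardsD1 x (D :\ v); rewrite Bx B2 add1n => -[<-].
  have : y \in D :\ v :\ x by rewrite By set11.
  rewrite !inE => /and3P[yx yv Dy].
  have := DE y; rewrite Dy /=; congr (_ \in E); apply/esym/eqP.
  rewrite eqEcard; apply/andP; split.
    apply/subsetP=> z; rewrite !inE => /orP[]/eqP->; first by rewrite eq_sym yv.
    by rewrite eq_sym yx.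
  have -> : #|D :\ y| = 2 by have := cardsD1 y D; rewrite Dy D3; lia.
  by rewrite cards2 eq_sym xv.
have le_tri : #|triangles E| <= #|triangles E'| + 'C(d, 2).
  rewrite -(cardsID [set D : {set T} | v \in D] (triangles E)) addnC leq_add //; last first.
    apply: leq_trans through_v; apply/subset_leq_card/subsetP=> D.
    by rewrite !inE.
  apply/subset_leq_card/subsetP=> D; rewrite !inE => /andP[vD /andP[-> /forallP DE]].
  apply/forallP=> x; apply/implyP=> Dx; have := DE x; rewrite Dx /= !inE => ->.
  by rewrite (negPf vD) !andbF.
apply: leq_trans le_tri _.
(* If [d <= t], the remainder drops to [t - d]. Otherwise one borrows: with [r.+1] for the old [r],
   ['C(r.+1, 2) + t - d = 'C(r, 2) + (r + t - d)], and the new remainder is below [r] since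
   [t < d]. *)
have [dt|td] := leqP d t.
  have := IH E' r (t - d) _ E'2 _ _; rewrite -/d in dv1 dvr.
  move=> /(_ ltac:(lia) ltac:(lia) ltac:(lia)) le.
  have := @bin2_convex (t - d) d 0 t ltac:(lia) ltac:(lia) ltac:(lia).
  rewrite (@bin_small 0 2) //; lia.
rewrite -/d in dv1 dvr; case: r dvr Er tr => // r dvr Er tr.
have := IH E' r (r + t - d) _ E'2 _ _; rewrite binS bin1 in Er.
move=> /(_ ltac:(lia) ltac:(lia) ltac:(lia)) le.
have := @bin2_convex (r + t - d) d t r ltac:(lia) ltac:(lia) ltac:(lia).
rewrite [in 'C(r.+1, 3)]binS; lia.
Qed.
End Triangles.

(** * Binary codes of finite sets *)

Section Codes.
Variable D : nat.
Implicit Types A B : {set 'I_D}.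

(* Adding a common element preserves the order of the codes, so that comparing
   codes orders pairs and triples compatibly. *)
Definition code A := \sum_(i in A) 2 ^ i.

Lemma codeD1 A i : i \in A -> code A = 2 ^ i + code (A :\ i).
Proof. by move=> Ai; rewrite /code (big_setD1 i). Qed.

Lemma code_lt A (m : nat) : (forall i, i \in A -> i < m) -> code A < 2 ^ m.
Proof.
elim: m A => [|m IH] A Am.
  suff -> : A = set0 by rewrite /code big_set0.
  by apply/setP=> i; rewrite inE; apply/negP=> /Am.
have IHm B : B \subset A -> (forall i, i \in B -> i != m :> nat) -> code B < 2 ^ m.
  move=> /subsetP sBA Bm; apply: IH => i Bi; have := Am i (sBA i Bi).
  by rewrite ltnS leq_eqVlt (negPf (Bm i Bi)).
have [/existsP[i /andP[Ai /eqP im]]|/existsPn nm] := boolP [exists i in A, i == m :> nat].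
  rewrite (codeD1 Ai) im expnS mul2n -addnn ltn_add2l; apply: IHm; rewrite ?subD1set //.
  by move=> j; rewrite in_setD1 -im => /andP[].
rewrite expnS; apply: leq_trans (IHm A _ _) _ => [//|i Ai|]; last by rewrite leq_pmull.
by have := nm i; rewrite Ai.
Qed.

(** The largest index at which two sets differ decides the comparison, since its power of two
    exceeds the sum of all smaller ones. *)
Lemma code_inj : injective code.
Proof.
suff lt A B i : i \in A -> i \notin B -> (forall j : 'I_D, i < j -> (j \in A) = (j \in B)) ->
    code B < code A.
  move=> A B eAB; apply: contraTeq isT => nAB.
  have [i0 Pi0] : exists i, (i \in A) != (i \in B).
    apply/existsP; apply: contraR nAB; rewrite negb_exists => /forallP H.
    by apply/eqP/setP=> i; apply/eqP; have := H i; rewrite negbK.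
  case: (@arg_maxnP _ i0 (fun i => (i \in A) != (i \in B)) (fun i => i : nat) Pi0) => i Pi maxi.
  have H (j : 'I_D) : i < j -> (j \in A) = (j \in B).
    move=> ij; apply/eqP; apply: contraLR ij => /maxi; by rewrite -leqNgt.
  case iA: (i \in A) Pi; case iB: (i \in B) => // _.
    by have := lt A B i iA (negbT iB) H; rewrite eAB ltnn.
  have := lt B A i iB (negbT iA) (fun j ij => esym (H j ij)).
  by rewrite eAB ltnn.
move=> Ai Bi H; pose hi := [set j in B | i < j].
have split (C : {set 'I_D}) : (forall j : 'I_D, i < j -> (j \in C) = (j \in B)) ->
    code C = code hi + code [set j in C | j <= i].
  move=> HC; rewrite /code (bigID (fun j : 'I_D => i < j)) /=; congr (_ + _).
    by apply: eq_bigl => j; rewrite inE; case: ltnP => [/HC->|]; rewrite ?andbF.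
  by apply: eq_bigl => j; rewrite inE -leqNgt.
rewrite (split A) // (split B) // ltn_add2l.
apply: (@leq_trans (2 ^ i)).
  apply: code_lt => j; rewrite inE => /andP[Bj]; rewrite leq_eqVlt => /orP[/eqP/val_inj eji|//].
  by rewrite eji (negPf Bi) in Bj.
by rewrite (codeD1 (i := i)) ?leq_addr // inE Ai leqnn.
Qed.

End Codes.

Import GRing.Theory Num.Theory.
Local Open Scope group_scope.

(** * Cohomologous cocycles and the commutator pairing *)

Definition cocycle_mul (gT : finGroupType) (f1 f2 : gT -> gT -> algC) x y : algC :=
  (f1 x y * f2 x y)%R.
Definition cocycle_inv (gT : finGroupType) (f : gT -> gT -> algC) x y : algC :=
  ((f x y)^-1)%R.
Definition cocycle_exp (gT : finGroupType) (f : gT -> gT -> algC) n x y : algC :=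
  (f x y ^+ n)%R.
Definition cocycle1 (gT : finGroupType) (x y : gT) : algC := 1%R.

Section Cohomologous.
Variables (gT : finGroupType) (G : {group gT}).
Implicit Types f : gT -> gT -> algC.

Lemma cohom_refl f : cohomologous G f f.
Proof.
exists (fun _ => 1%R); split=> [x _|x y _ _]; first exact: oner_neq0.
by rewrite invr1 !mulr1.
Qed.

Lemma cohom_eq f1 f2 :
  (forall x y, x \in G -> y \in G -> f1 x y = f2 x y) -> cohomologous G f1 f2.
Proof.
move=> e; have [g [g0 H]] := cohom_refl f2; exists g; split=> // x y Gx Gy.
by rewrite e // -H.
Qed.

Lemma cohom_mul f1 f2 g1 g2 :
  cohomologous G f1 g1 -> cohomologous G f2 g2 ->
  cohomologous G (cocycle_mul f1 f2) (cocycle_mul g1 g2).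
Proof.
move=> [u [u0 Hu]] [v [v0 Hv]]; exists (fun x => (u x * v x)%R); split.
  by move=> x Gx; rewrite mulf_neq0 ?u0 ?v0.
move=> x y Gx Gy; rewrite /cocycle_mul Hu // Hv //.
by field; rewrite u0 ?v0 ?groupM.
Qed.

Lemma cohom_inv f g :
  cohomologous G f g -> cohomologous G (cocycle_inv f) (cocycle_inv g).
Proof.
move=> [u [u0 Hu]]; exists (fun x => ((u x)^-1)%R); split.
  by move=> x Gx; rewrite invr_neq0 ?u0.
move=> x y Gx Gy; rewrite /cocycle_inv Hu // !invfM invrK.
by rewrite mulrA.
Qed.

Lemma cohom_sym f g : cohomologous G f g -> cohomologous G g f.
Proof.
move=> [u [u0 Hu]]; exists (fun x => ((u x)^-1)%R); split.
  by move=> x Gx; rewrite invr_neq0 ?u0.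
move=> x y Gx Gy; rewrite Hu //.
by field; rewrite ?u0 ?groupM.
Qed.

Lemma cohom_trans f g h :
  cohomologous G f g -> cohomologous G g h -> cohomologous G f h.
Proof.
move=> [u [u0 Hu]] [v [v0 Hv]]; exists (fun x => (u x * v x)%R); split.
  by move=> x Gx; rewrite mulf_neq0 ?u0 ?v0.
move=> x y Gx Gy; rewrite Hu // Hv //.
by field; rewrite u0 ?v0 ?groupM.
Qed.

Lemma cohom_exp f g n :
  cohomologous G f g -> cohomologous G (cocycle_exp f n) (cocycle_exp g n).
Proof.
move=> [u [u0 Hu]]; exists (fun x => (u x ^+ n)%R); split.
  by move=> x Gx; rewrite expf_neq0 ?u0.
by move=> x y Gx Gy; rewrite /cocycle_exp Hu // !exprMn exprVn.
Qed.

Lemma cocycleM f g :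
  mult_cocycle G f -> mult_cocycle G g -> mult_cocycle G (cocycle_mul f g).
Proof.
move=> [f0 Hf] [g0 Hg]; split=> [x y Gx Gy|x y z Gx Gy Gz].
  by rewrite mulf_neq0 ?f0 ?g0.
by rewrite /cocycle_mul mulrACA Hf // Hg // mulrACA.
Qed.

Lemma cocycleV f : mult_cocycle G f -> mult_cocycle G (cocycle_inv f).
Proof.
move=> [f0 Hf]; split=> [x y Gx Gy|x y z Gx Gy Gz].
  by rewrite invr_neq0 ?f0.
by rewrite /cocycle_inv -!invfM Hf.
Qed.

Lemma cohom_divP f g : mult_cocycle G g ->
  cohomologous G (cocycle_mul f (cocycle_inv g)) (@cocycle1 gT) ->
  cohomologous G f g.
Proof.
move=> [g0 _] /(fun h => cohom_mul h (cohom_refl g)) h.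
apply: cohom_trans (cohom_trans _ h) _; apply: cohom_eq => x y Gx Gy.
  by rewrite /cocycle_mul /cocycle_inv mulfVK ?g0.
by rewrite /cocycle_mul mul1r.
Qed.

Lemma cohom_div f g : mult_cocycle G g -> cohomologous G f g ->
  cohomologous G (cocycle_mul f (cocycle_inv g)) (@cocycle1 gT).
Proof.
move=> [g0 _] h; apply: cohom_trans (cohom_mul h (cohom_refl _)) _.
by apply: cohom_eq => x y Gx Gy; rewrite /cocycle_mul /cocycle_inv divff ?g0.
Qed.

Lemma cocycle_cohom f g :
  mult_cocycle G g -> cohomologous G f g -> mult_cocycle G f.
Proof.
move=> [g0 Hg] [u [u0 Hu]]; split=> [x y Gx Gy|x y z Gx Gy Gz].
  by rewrite Hu // !mulf_neq0 ?invr_neq0 ?u0 ?g0 ?groupM.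
rewrite !Hu ?groupM // !mulgA.
transitivity (g x y * g (x * y)%g z * (u x * u y * u z / u (x * y * z)%g))%R.
  by field; rewrite ?u0 ?groupM.
rewrite Hg //; by field; rewrite ?u0 ?groupM.
Qed.

End Cohomologous.

Section Restriction.
Variables (gT : finGroupType) (G H : {group gT}).

Lemma cocycleS f : H \subset G -> mult_cocycle G f -> mult_cocycle H f.
Proof.
move=> /subsetP sHG [f0 Hf]; split=> [x y Hx Hy|x y z Hx Hy Hz].
  by apply: f0; apply: sHG.
by apply: Hf; apply: sHG.
Qed.

End Restriction.

Section Pullback.
Variables (aT rT : finGroupType) (D G : {group aT}) (phi : {morphism D >-> rT}).
Hypothesis sGD : G \subset D.

Definition pull (f : rT -> rT -> algC) x y := f (phi x) (phi y).

Lemma cocycle_pull f : mult_cocycle (phi @* G) f -> mult_cocycle G (pull f).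
Proof.
move/subsetP: sGD => sGD' [f0 Hf]; split=> [x y Gx Gy|x y z Gx Gy Gz].
  by apply: f0; apply: mem_morphim => //; apply: sGD'.
by rewrite /pull !morphM ?sGD' // Hf // mem_morphim // sGD'.
Qed.

Lemma cohom_pull f g :
  cohomologous (phi @* G) f g -> cohomologous G (pull f) (pull g).
Proof.
move/subsetP: sGD => sGD' [u [u0 Hu]].
exists (u \o phi); split=> [x Gx|x y Gx Gy] /=.
  by rewrite u0 // mem_morphim // sGD'.
by rewrite morphM ?sGD' // -Hu // mem_morphim // sGD'.
Qed.
End Pullback.

(** * The commutator pairing of a cocycle *)

Definition beta (gT : finGroupType) (f : gT -> gT -> algC) x y : algC :=
  (f x y / f y x)%R.

(** The kernel of [chi] in [G] is a subgroup. This is how triviality of a pairing spreads from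
    generators. *)
Lemma mult_hom_gen (gT : finGroupType) (G : {group gT}) (A : {set gT})
    (chi : gT -> algC) :
  (forall x, x \in G -> chi x != 0%R) ->
  (forall x y, x \in G -> y \in G -> chi (x * y) = (chi x * chi y)%R) ->
  A \subset G -> (forall a, a \in A -> chi a = 1%R) ->
  forall x, x \in <<A>> -> chi x = 1%R.
Proof.
move=> chi0 chiM sAG chiA.
have chi1 : chi 1 = 1%R.
  have := chiM _ _ (group1 G) (group1 G); rewrite mulg1 => /esym/eqP.
  by rewrite -{3}[chi 1]mulr1 (inj_eq (mulfI (chi0 _ (group1 G)))) => /eqP.
pose K := [set x in G | chi x == 1%R].
have gK : group_set K.
  apply/group_setP; split; first by rewrite inE group1 chi1 eqxx.
  move=> x y; rewrite !inE => /andP[Gx /eqP cx] /andP[Gy /eqP cy].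
  by rewrite groupM // chiM // cx cy mulr1 eqxx.
have sub : <<A>> \subset Group gK.
  by rewrite gen_subG; apply/subsetP=> a Aa; rewrite inE (subsetP sAG) // chiA /=.
by move=> x /(subsetP sub); rewrite inE => /andP[_ /eqP].
Qed.

Lemma mult_hom_der1 (gT : finGroupType) (G : {group gT}) (chi : gT -> algC) :
  (forall x, x \in G -> chi x != 0%R) ->
  (forall x y, x \in G -> y \in G -> chi (x * y) = (chi x * chi y)%R) ->
  forall x, x \in G^`(1) -> chi x = 1%R.
Proof.
move=> chi0 chiM; rewrite derg1; apply: (@mult_hom_gen _ G (commg_set G G) chi chi0 chiM).
  by apply: subset_trans (der_sub 1 G); rewrite derg1; apply: subset_gen.
move=> _ /imset2P[x y Gx Gy ->].
have yx0 : chi (y * x) != 0%R by rewrite chi0 ?groupM.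
have Gr : [~ x, y] \in G by rewrite groupR.
apply: (mulfI yx0); rewrite mulr1 -(chiM _ _ (groupM Gy Gx) Gr) -commgC.
by rewrite !chiM // mulrC.
Qed.

Section Beta.
Variables (gT : finGroupType) (G : {group gT}) (f : gT -> gT -> algC).
Hypothesis Zf : mult_cocycle G f.
Let f0 := Zf.1.
Let fM := Zf.2.

Lemma beta_neq0 x y : x \in G -> y \in G -> beta f x y != 0%R.
Proof. by move=> Gx Gy; rewrite mulf_neq0 ?invr_neq0 ?f0. Qed.

Lemma betaV x y : x \in G -> y \in G -> beta f y x = ((beta f x y)^-1)%R.
Proof. by move=> Gx Gy; rewrite /beta invfM invrK mulrC. Qed.

Lemma betaxx x : x \in G -> beta f x x = 1%R.
Proof. by move=> Gx; rewrite /beta divff ?f0. Qed.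

(** The cocycle identities for [(n, x, y)], [(x, n, y)] and [(x, y, n)] combine, because [n] may be
    moved past [x] and [y] inside the arguments. *)
Lemma betaMr n x y : n \in G -> x \in G -> y \in G ->
  commute n x -> commute n y -> beta f n (x * y) = (beta f n x * beta f n y)%R.
Proof.
move=> Gn Gx Gy cx cy; have := fM Gn Gx Gy; have := fM Gx Gn Gy; have := fM Gx Gy Gn.
rewrite /beta -cx -cy => e3 e2 e1.
have -> : f n (x * y) = (f n x * f (n * x)%g y / f x y)%R.
  by rewrite e1 mulrAC divff ?f0 ?groupM // mul1r.
have -> : f (x * y) n = (f y n * f x (n * y)%g / f x y)%R.
  by rewrite -e3 mulrAC divff ?f0 ?groupM // mul1r.
have -> : f (n * x) y = (f n y * f x (n * y)%g / f x n)%R.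
  by rewrite -e2 mulrAC divff ?f0 ?groupM // mul1r.
by field; rewrite ?f0 ?groupM.
Qed.

Lemma betaMl n x y : n \in G -> x \in G -> y \in G ->
  commute n x -> commute n y -> beta f (x * y) n = (beta f x n * beta f y n)%R.
Proof.
move=> Gn Gx Gy cx cy.
by rewrite (betaV Gn) ?(betaV Gn Gx) ?(betaV Gn Gy) ?groupM // betaMr // invfM.
Qed.

Lemma beta1r n : n \in G -> beta f n 1 = 1%R.
Proof.
move=> Gn; have b0 := beta_neq0 Gn (group1 G).
apply: (mulfI b0); rewrite -betaMr ?mulg1 ?mulr1 //; exact: commute1.
Qed.

Lemma betaX n x k : n \in G -> x \in G -> commute n x ->
  beta f (n ^+ k) x = (beta f n x ^+ k)%R.
Proof.
move=> Gn Gx c; elim: k => [|k IH].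
  by rewrite expg0 expr0 (betaV Gx) // beta1r // invr1.
rewrite expgS exprS betaMl ?groupX // ?IH //.
by apply: commuteX; apply: commute_sym.
Qed.

(** For central [z] the map [beta f z] is a homomorphism from [G] to a commutative group. *)
Lemma beta_center_der1 z w : z \in 'Z(G) -> w \in G^`(1) -> beta f z w = 1%R.
Proof.
case/centerP=> Gz cz Gw.
apply: (@mult_hom_der1 _ G (beta f z)) => // [x Gx|x y Gx Gy].
  exact: beta_neq0.
by apply: betaMr => //; apply: cz.
Qed.

End Beta.

(** A coboundary is symmetric on commuting pairs, so it cancels in the quotient. *)
Lemma beta_cohom (gT : finGroupType) (G : {group gT}) f g x y :
  mult_cocycle G g -> cohomologous G f g -> x \in G -> y \in G -> commute x y ->
  beta f x y = beta g x y.
Proof.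
move=> [g0 _] [u [u0 Hu]] Gx Gy c; rewrite /beta !Hu // -c.
by field; rewrite ?u0 ?g0 ?groupM.
Qed.

Lemma beta_mul (gT : finGroupType) (f g : gT -> gT -> algC) x y :
  beta (cocycle_mul f g) x y = (beta f x y * beta g x y)%R.
Proof. by rewrite /beta /cocycle_mul invfM mulrACA. Qed.

Lemma beta_inv (gT : finGroupType) (f : gT -> gT -> algC) x y :
  beta (cocycle_inv f) x y = ((beta f x y)^-1)%R.
Proof. by rewrite /beta /cocycle_inv invfM. Qed.

(** * Transfer, inflation and transgression *)

(** The trivializing cochain on [H] is extended by 1 to [G], and its coboundary is divided out. *)
Lemma cohom_trivial_normalize (gT : finGroupType) (G H : {group gT}) f :
  H \subset G -> mult_cocycle G f -> cohomologous H f (@cocycle1 gT) ->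
  exists f', [/\ mult_cocycle G f', cohomologous G f f' &
    forall x y, x \in H -> y \in H -> f' x y = 1%R].
Proof.
move=> sHG Zf [u [u0 Hu]].
pose v x := if x \in H then u x else 1%R.
have v0 x : v x != 0%R.
  by rewrite /v; case: ifP => [/u0 //|_]; exact: oner_neq0.
pose f' x y := (f x y * ((v x)^-1 * (v y)^-1 / (v (x * y)%g)^-1))%R.
have cf : cohomologous G f' f.
  by exists (fun x => ((v x)^-1)%R); split=> // x _; rewrite invr_neq0.
exists f'; split; first exact: cocycle_cohom Zf cf.
  exact: cohom_sym.
move=> x y Hx Hy; rewrite /f' /v Hx Hy groupM // Hu // /cocycle1.
by field; rewrite !u0 ?groupM.
Qed.

Section Transfer.
Variables (gT : finGroupType) (G H : {group gT}).
Hypothesis sHG : H \subset G.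

(* If u_t u_x = a(t, x) u_h u_t' with h in H, then f(x, y) a(t, xy) = a(t, x) a(t', y);
   multiply over a transversal. *)
Lemma transfer_normalized f : mult_cocycle G f ->
  (forall x y, x \in H -> y \in H -> f x y = 1%R) ->
  cohomologous G (cocycle_exp f #|G : H|) (@cocycle1 gT).
Proof.
move=> [f0 fM] f1.
(* The transversal is [t = repr C], with [t' = repr (C :* x)]; [h C x] is the element of [H] such
   that [t * x = h C x * t']. *)
pose h (C : {set gT}) x := repr C * x * (repr (C :* x))^-1.
pose a (C : {set gT}) x := (f (repr C) x / f (h C x) (repr (C :* x)))%R.
have rcG C : C \in rcosets H G -> repr C \in G /\ C = H :* repr C.
  case/rcosetsP=> z Gz ->; split; last by rewrite rcoset_repr.
  by have := mem_repr_rcoset H z; apply/subsetP; rewrite mul_subG ?sub1set.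
have rcx C x : C \in rcosets H G -> x \in G -> C :* x \in rcosets H G.
  case/rcosetsP=> z Gz -> Gx; rewrite -rcosetM; apply/rcosetsP.
  by exists (z * x); rewrite ?groupM.
have hH C x : C \in rcosets H G -> x \in G -> h C x \in H.
  move=> RC Gx; have [_ e] := rcG _ RC; have [_ e'] := rcG _ (rcx _ _ RC Gx).
  rewrite /h -mem_rcoset -e' {2}e -rcosetM; exact: rcoset_refl.
have hE C x : repr C * x = h C x * repr (C :* x) by rewrite /h mulgKV.
have a0 C x : C \in rcosets H G -> x \in G -> a C x != 0%R.
  move=> RC Gx; have [Gr _] := rcG _ RC; have [Gr' _] := rcG _ (rcx _ _ RC Gx).
  by rewrite mulf_neq0 ?invr_neq0 ?f0 ?(subsetP sHG _ (hH _ _ RC Gx)).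
have key C x y : C \in rcosets H G -> x \in G -> y \in G ->
    f x y = (a C x * a (C :* x) y / a C (x * y)%g)%R.
  move=> RC Gx Gy; have RCx := rcx _ _ RC Gx; have RCy := rcx _ _ RCx Gy.
  have [Gr _] := rcG _ RC; have [Gr' _] := rcG _ RCx; have [Gr'' _] := rcG _ RCy.
  have Hh := hH _ _ RC Gx; have Hh' := hH _ _ RCx Gy.
  have Gh := subsetP sHG _ Hh; have Gh' := subsetP sHG _ Hh'.
  have hM : h C (x * y) = h C x * h (C :* x) y.
    by rewrite /h !mulgA mulgKV -!rcosetM.
  rewrite /a hM -!rcosetM in RCy Gr'' *.
  set t := repr C in Gr *; set t' := repr (C :* x) in Gr' *.
  set t'' := repr (C :* (x * y)) in Gr'' *.
  have e1 : t * x = h C x * t' by exact: hE.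
  have e2 : t' * y = h (C :* x) y * t'' by rewrite /t' hE -rcosetM.
  move: (h C x) (h (C :* x) y) Hh Hh' Gh Gh' e1 e2 => k k' Hk Hk' Gk Gk' e1 e2.
  have := fM _ _ _ Gr Gx Gy; rewrite e1 => E1.
  have := fM _ _ _ Gk Gr' Gy; rewrite e2 => E2.
  (* The normalization of [f] on [H] enters here, through [f k k' = 1]. *)
  have := fM _ _ _ Gk Gk' Gr''; rewrite (f1 k k') // mul1r => E3.
  have -> : f t (x * y)%g = (f t x * f (k * t')%g y / f x y)%R.
    by rewrite E1 mulrAC divff ?f0 ?groupM // mul1r.
  have -> : f (k * t') y = (f t' y * f k (k' * t'')%g / f k t')%R.
    by rewrite -E2 mulrAC divff ?f0 ?groupM // mul1r.
  rewrite E3; by field; rewrite ?f0 ?groupM.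
exists (fun x => \prod_(C in rcosets H G) a C x)%R; split.
  by move=> x Gx; apply/prodf_neq0 => C RC; apply: a0.
move=> x y Gx Gy; rewrite /cocycle_exp /cocycle1 mul1r -prodr_const.
rewrite (eq_bigr _ (fun C RC => key C x y RC Gx Gy)) prodf_div big_split /=.
congr (_ * _ / _)%R.
(* Right multiplication by [x] permutes the cosets. *)
rewrite [RHS](reindex_onto (fun C => C :* x) (fun C => C :* x^-1)) /=.
  apply: eq_bigl => C; rewrite -rcosetM mulgV mulg1 eqxx andbT.
  apply/idP/idP => [RC|RC]; first exact: rcx.
  by rewrite -(rcosetK x C); apply: (rcx _ x^-1 RC); rewrite groupV.
by move=> C _; rewrite -rcosetM mulVg mulg1.
Qed.

Lemma cohom_transfer f : mult_cocycle G f -> cohomologous H f (@cocycle1 gT) ->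
  cohomologous G (cocycle_exp f #|G : H|) (@cocycle1 gT).
Proof.
move=> Zf /(cohom_trivial_normalize sHG Zf)[f' [Zf' cf f'1]].
exact: cohom_trans (cohom_exp _ cf) (transfer_normalized Zf' f'1).
Qed.

End Transfer.

(* The twisted group algebra is commutative, hence has a character, which is
   read off a common eigenvector of its regular representation. *)
Lemma symmetric_cocycle (gT : finGroupType) (A : {group gT}) f :
  abelian A -> mult_cocycle A f ->
  (forall x y, x \in A -> y \in A -> f x y = f y x) ->
  cohomologous A f (@cocycle1 gT).
Proof.
move=> cAA [f0 fM] fC.
pose n := #|A|; pose e (i : 'I_n) : gT := enum_val i.
have eA i : e i \in A by exact: enum_valP.
(* Row [i] records the product of the basis elements of [a] and [e i], namely [f a (e i)] times that
   of [a * e i]. *)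
pose M a : 'M[algC]_n :=
  (\matrix_(i, j) if e j == (a * e i)%g then f a (e i) else 0)%R.
have MM a b : a \in A -> b \in A -> (M a *m M b = f a b *: M (a * b)%g)%R.
  move=> Aa Ab; apply/matrixP=> i j; rewrite !mxE.
  have Aai : a * e i \in A by rewrite groupM.
  pose k : 'I_n := enum_rank_in Aai (a * e i).
  have ek : e k = a * e i by rewrite /e enum_rankK_in.
  rewrite (bigD1 k) //= big1 => [|l lk]; last first.
    rewrite !mxE; case: eqP => [el|_]; last by rewrite mul0r.
    by case/eqP: lk; apply: enum_val_inj; rewrite -/(e l) -/(e k) ek.
  rewrite !mxE ek eqxx addr0 mulgA (centsP cAA _ Ab _ Aa).
  case: ifP => _; last by rewrite !mulr0.
  by rewrite (fC a b) // (centsP cAA _ Aa _ Ab) fM // mulrC.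
have n0 : (0 < n)%N by exact: cardG_gt0.
have [|v v0 /allP Hv] := @common_eigenvector algC n [seq M a | a <- enum A] n0.
  move=> _ _ /mapP[a Aa ->] /mapP[b Ab ->]; rewrite mem_enum in Aa; rewrite mem_enum in Ab.
  by rewrite /comm_mx !MM // fC // (centsP cAA _ Aa _ Ab).
have [k vk] : exists k, v 0%R k != 0%R by apply/rV0Pn.
(* The eigenvalue of [M a] at the common eigenvector [v], read at a nonzero coordinate. *)
pose g a : algC := ((v *m M a) 0 k / v 0 k)%R.
have Hg a : a \in A -> (v *m M a = g a *: v)%R.
  move=> Aa; have : stablemx v (M a).
    by apply: Hv; apply: map_f; rewrite mem_enum.
  case/sub_rVP=> c cE; rewrite /g cE; congr (_ *: _)%R.
  by rewrite mxE mulfK.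
have gM a b : a \in A -> b \in A -> (g a * g b = f a b * g (a * b)%g)%R.
  move=> Aa Ab; apply: (mulIf vk).
  have /(congr1 (fun w : 'rV_n => w 0%R k)) : (v *m (M a *m M b) = v *m (f a b *: M (a * b)%g))%R.
    by rewrite MM.
  rewrite mulmxA Hg // -scalemxAl Hg // -scalemxAr Hg ?groupM // !mxE.
  by rewrite !mulrA.
(* [M a] permutes the coordinates up to nonzero scalars, so a zero eigenvalue would force
   [v = 0]. *)
have g0 a : a \in A -> g a != 0%R.
  move=> Aa; apply: contraNneq v0 => ga0; apply/eqP/rowP=> i; rewrite mxE.
  have Aai : a * e i \in A by rewrite groupM.
  pose j : 'I_n := enum_rank_in Aai (a * e i).
  have ej : e j = a * e i by rewrite /e enum_rankK_in.
  have := Hg a Aa; rewrite ga0 scale0r => /(congr1 (fun w : 'rV_n => w 0%R j)).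
  rewrite !mxE (bigD1 i) //= big1 => [|l li]; last first.
    rewrite !mxE ej; case: eqP => [/mulgI el|_]; last by rewrite mulr0.
    by case/eqP: li; apply: enum_val_inj.
  by rewrite !mxE ej eqxx addr0 => /eqP; rewrite mulf_eq0 (negPf (f0 _ _ _ _)) ?orbF // => /eqP.
exists g; split=> // x y Ax Ay.
by rewrite /cocycle1 mul1r gM // mulfK ?g0 ?groupM.
Qed.

(** * Descent, inflation and transgression for a central subgroup *)

Section CentralQuotient.
Variables (gT : finGroupType) (G N : {group gT}).
Hypothesis sNZ : N \subset 'Z(G).

Let sNG : N \subset G. Proof. exact: subset_trans sNZ (center_sub G). Qed.
Let nNG : G \subset 'N(N).
Proof. by rewrite cents_norm // centsC; apply: subset_trans sNZ _; rewrite subsetIr. Qed.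
Let cN n x : n \in N -> x \in G -> n * x = x * n.
Proof. by move=> /(subsetP sNZ)/centerP[_ c] /c. Qed.
Let NG n : n \in N -> n \in G. Proof. exact: (subsetP sNG). Qed.

(** A transversal of [N] in [G]; every [x] factors as [nu x * rho x] with [nu x] in [N]. *)
Let rho (x : gT) : gT := repr (coset N x).
Let nu x := x * (rho x)^-1.

Let rhoE x : x \in G -> exists2 n, n \in N & rho x = n * x.
Proof.
move=> Gx; rewrite /rho val_coset ?(subsetP nNG) //.
by case/rcosetP: (mem_repr_rcoset N x) => n Nn ->; exists n.
Qed.

Let rhoG x : x \in G -> rho x \in G.
Proof. by move=> Gx; have [n /NG Gn ->] := rhoE Gx; rewrite groupM. Qed.

Let rhoM n x : n \in N -> x \in G -> rho (n * x) = rho x.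
Proof. by move=> Nn Gx; rewrite /rho coset_kerl. Qed.

Let nuN x : x \in G -> nu x \in N.
Proof.
by move=> Gx; rewrite /nu; have [n Nn ->] := rhoE Gx; rewrite invMg mulKVg groupV.
Qed.

Let nuK x : nu x * rho x = x. Proof. exact: mulgKV. Qed.

Let nuM n x : n \in N -> x \in G -> nu (n * x) = n * nu x.
Proof. by move=> Nn Gx; rewrite /nu rhoM // mulgA. Qed.

Lemma cocycle_descent F : mult_cocycle G F ->
  (forall n x y, n \in N -> x \in G -> y \in G ->
     F (n * x) y = F x y /\ F x (n * y) = F x y) ->
  exists2 phi, mult_cocycle (G / N) phi &
    forall x y, x \in G -> y \in G -> phi (coset N x) (coset N y) = F x y.
Proof.
move=> [F0 FM] FN; pose phi (X Y : coset_of N) := F (repr X) (repr Y).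
have phiE x y : x \in G -> y \in G -> phi (coset N x) (coset N y) = F x y.
  move=> Gx Gy; rewrite /phi -/(rho x) -/(rho y).
  have [m Nm ->] := rhoE Gx; have [n Nn ->] := rhoE Gy.
  have Gnx : n * y \in G by rewrite groupM // NG.
  by rewrite (FN _ _ _ Nm Gx Gnx).1 (FN _ _ _ Nn Gx Gy).2.
exists phi => //; split.
  by move=> _ _ /morphimP[x nx Gx ->] /morphimP[y ny Gy ->]; rewrite phiE ?F0.
move=> _ _ _ /morphimP[x nx Gx ->] /morphimP[y ny Gy ->] /morphimP[z nz Gz ->].
by rewrite -!morphM // !phiE ?groupM // FM.
Qed.

(** On [N] the cocycle is symmetric, hence can be made trivial there. A change of lifts compatible
    with multiplication by [N] then makes it invariant under [N]; the hypothesis on the pairing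
    gives the invariance in the second argument. *)
Lemma cocycle_inflated f : mult_cocycle G f ->
  (forall n x, n \in N -> x \in G -> beta f n x = 1%R) ->
  exists2 phi, mult_cocycle (G / N) phi &
    cohomologous G f (fun x y => phi (coset N x) (coset N y)).
Proof.
move=> Zf bf.
have cNN : abelian N by apply: abelianS sNZ (center_abelian G).
have Zf1 := cocycleS sNG Zf.
have [|f' [Zf' cf f'1]] := cohom_trivial_normalize sNG Zf.
  apply: symmetric_cocycle => // x y Nx Ny.
  have /(congr1 (fun a => a * f y x)%R) := bf x y Nx (NG Ny).
  by rewrite mul1r /beta mulfVK // Zf.1 ?NG.
have fC n x : n \in N -> x \in G -> f' n x = f' x n.
  move=> Nn Gx; have Gn := NG Nn.
  have := bf n x Nn Gx; rewrite (beta_cohom Zf' cf Gn Gx (cN Nn Gx)).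
  move/(congr1 (fun a => a * f' x n)%R).
  by rewrite mul1r /beta mulfVK // Zf'.1.
have [f0 fM] := Zf'.
(* The new lift [v_x = u_(nu x) u_(rho x)] equals [g x] times [u_x], so that [v_(n x) = u_n v_x] for
   [n] in [N]; [F] below is the cocycle of these lifts. *)
pose g x := f' (nu x) (rho x).
have g0 x : x \in G -> g x != 0%R by move=> Gx; rewrite f0 ?rhoG // NG ?nuN.
have gM n x : n \in N -> x \in G -> g (n * x) = (g x * f' n x)%R.
  move=> Nn Gx; have Nx := nuN Gx; have := fM _ _ _ (NG Nn) (NG Nx) (rhoG Gx).
  by rewrite f'1 // mul1r nuK /g nuM // rhoM.
pose F x y := (f' x y * (g x * g y / g (x * y)%g))%R.
have cF : cohomologous G F f' by exists g.
have ZF : mult_cocycle G F := cocycle_cohom Zf' cF.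
have [|phi Zphi phiE] := cocycle_descent ZF.
  move=> n x y Nn Gx Gy; have Gn := NG Nn.
  have e1 := fM _ _ _ Gn Gx Gy; have e2 := fM _ _ _ Gx Gn Gy.
  rewrite /F (mulgA x) -(cN Nn Gx) -mulgA
    (gM n x) // (gM n y) // (gM n (x * y)) ?groupM //; split.
    have -> : f' (n * x) y = (f' x y * f' n (x * y)%g / f' n x)%R.
      by rewrite -e1 mulrAC divff ?f0 ?groupM // mul1r.
    by field; rewrite ?g0 ?f0 ?groupM.
  have -> : f' x (n * y) = (f' n x * f' (n * x)%g y / f' n y)%R.
    by rewrite (fC n x) // (cN Nn Gx) e2 mulrAC divff ?f0 ?groupM // mul1r.
  by rewrite e1; field; rewrite ?g0 ?f0 ?groupM.
exists phi => //; apply: cohom_trans cf (cohom_trans (cohom_sym cF) _).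
by apply: cohom_eq => x y Gx Gy; rewrite phiE.
Qed.

(** The character is extended along the transversal by [psi x = chi (nu x)]. The factors from [N]
    cancel in the coboundary of [psi], which therefore descends to [G / N]. *)
Lemma transgression (chi : gT -> algC) :
  (forall n, n \in N -> chi n != 0%R) ->
  {in N &, {morph chi : x y / x * y >-> (x * y)%R}} ->
  exists psi : gT -> algC, [/\ forall x, x \in G -> psi x != 0%R,
    forall n x, n \in N -> x \in G -> psi (n * x) = (chi n * psi x)%R &
    exists2 tau, mult_cocycle (G / N) tau & forall x y, x \in G -> y \in G ->
      tau (coset N x) (coset N y) = (psi x * psi y / psi (x * y)%g)%R].
Proof.
move=> chi0 chiM; pose psi x := chi (nu x).
have psi0 x : x \in G -> psi x != 0%R by move=> Gx; rewrite chi0 ?nuN.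
have psiM n x : n \in N -> x \in G -> psi (n * x) = (chi n * psi x)%R.
  by move=> Nn Gx; rewrite /psi nuM // chiM ?nuN.
exists psi; split=> //.
pose F x y := (psi x * psi y / psi (x * y)%g)%R.
have ZF : mult_cocycle G F.
  apply: (@cocycle_cohom _ _ _ (@cocycle1 gT)).
    by split=> [*|*]; rewrite /cocycle1 ?oner_neq0.
  by exists psi; split=> // x y Gx Gy; rewrite /F /cocycle1 mul1r.
have [|tau Zt tauE] := cocycle_descent ZF; last by exists tau.
move=> n x y Nn Gx Gy; rewrite /F (mulgA x) -(cN Nn Gx) -mulgA
  (psiM n x) // (psiM n y) // (psiM n (x * y)) ?groupM //.
by split; field; rewrite ?psi0 ?chi0 ?groupM.
Qed.

End CentralQuotient.

(** * Bounds on the number of classes *)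

(** A finite family of distinct classes: such families allow counting without forming the group
    M(G). *)
Definition indep (gT : finGroupType) (G : {set gT}) (I : finType) (A : {set I})
    (h : I -> gT -> gT -> algC) : Prop :=
  (forall i, i \in A -> mult_cocycle G (h i)) /\
  (forall i j, i \in A -> j \in A -> cohomologous G (h i) (h j) -> i = j).

(* [mult_bound G c d] says |M(G)| * c <= d. *)
Definition mult_bound (gT : finGroupType) (G : {set gT}) (c d : nat) : Prop :=
  forall (I : finType) (A : {set I}) h, indep G A h -> #|A| * c <= d.

Lemma pigeonhole (I J : finType) (A : {set I}) (c : I -> J) :
  exists A' : {set I}, [/\ A' \subset A, #|A| <= #|J| * #|A'| &
    {in A' &, forall i j, c i = c j}].
Proof.
have [->|[i0 Ai0]] := set_0Vmem A.
  by exists set0; split; rewrite ?sub0set ?cards0 // => i j; rewrite inE.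
pose B j := [set i in A | c i == j].
pose j1 := [arg max_(j > c i0) #|B j|].
have Bmax j : #|B j| <= #|B j1| by rewrite /j1; case: arg_maxnP => // k _; apply.
exists (B j1); split.
- by apply/subsetP=> i; rewrite inE => /andP[].
- rewrite -sum1_card (partition_big c predT) //= -sum_nat_const.
  apply: leq_sum => j _; apply: leq_trans (Bmax j); rewrite -sum1_card.
  by apply/eq_leq/eq_bigl => i; rewrite inE.
by move=> i j; rewrite !inE => /andP[_ /eqP->] /andP[_ /eqP->].
Qed.

(** A maximal independent family represents every class. Starting from the empty family, any cocycle
    not yet represented is adjoined, and [b] bounds the number of extensions. *)
Lemma max_indep (gT : finGroupType) (G : {group gT}) b : mult_bound G 1 b ->
  exists2 m, m <= b & schur_mult_le G m.
Proof.
move=> bG; have card_le I A h : @indep gT G I A h -> #|A| <= b.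
  by move=> /bG; rewrite muln1.
suff ext k : forall (I : finType) (h : I -> gT -> gT -> algC),
    indep G [set: I] h -> b - #|I| <= k -> exists2 m, m <= b & schur_mult_le G m.
  apply: (ext b void (fun=> @cocycle1 gT)); last by rewrite leq_subr.
  by split=> [[]|[]].
elim: k => [|k IHk] I h ih le_k.
all: have leI : #|I| <= b by rewrite -cardsT; apply: card_le ih.
all: have [[f [Zf nf]]|all_f] := classic (exists f, mult_cocycle G f /\
  forall i, ~ cohomologous G f (h i)); last first.
1,3: exists #|I| => //; exists (fun i => h (enum_val i)) => f Zf;
  apply: NNPP => nf; case: all_f; exists f; split=> // i cfi;
  by case: nf; exists (enum_rank i); rewrite enum_rankK.
all: pose h' o := if o is Some i then h i else f.
all: have ih' : indep G [set: option I] h'.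
1,3: split=> [[i|] _ //|[i|] [j|] _ _ //]; [exact: ih.1| | |];
  [by move/(ih.2 _ _ (in_setT i) (in_setT j))=> ->
  |by move/cohom_sym/nf|by move/nf].
- have := card_le _ _ _ ih'; rewrite cardsT card_option => lt.
  by move: le_k; rewrite leqn0 subn_eq0 leqNgt lt.
apply: IHk ih' _; rewrite card_option; lia.
Qed.

Lemma mult_bound_isog (aT rT : finGroupType) (G : {group aT}) (H : {group rT}) c d :
  G \isog H -> mult_bound H c d -> mult_bound G c d.
Proof.
case/isogP=> phi injphi defH bH I A h [Zh hI].
have imG : invm injphi @* H = G by rewrite -defH /= im_invm.
have sH : H \subset phi @* G by rewrite defH.
apply: (bH I A (fun i => pull (invm injphi) (h i))); split=> [i Ai|i j Ai Aj].
  by apply: cocycle_pull => //; rewrite imG; apply: Zh.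
rewrite -defH => /(cohom_pull (subxx G)) cij; apply: (hI _ _ Ai Aj).
apply: cohom_trans (cohom_trans _ cij) _; apply: cohom_eq => x y Gx Gy.
  by rewrite /pull /= !invmE.
by rewrite /pull /= !invmE.
Qed.

(** A test [(n, g, e)] marks a place where the pairing is an [e]-th root of unity for every cocycle,
    hence takes at most [e] values. *)
Definition is_test (gT : finGroupType) (G N : {set gT}) (t : gT * gT * nat) :=
  [/\ t.1.1 \in N, t.1.2 \in G, 0 < t.2 &
      forall f, mult_cocycle G f -> (beta f t.1.1 t.1.2 ^+ t.2 = 1)%R].

(** The pigeonhole principle is applied test by test to the exponents of the values with respect to
    a primitive root of unity. *)
Lemma equal_tests (gT : finGroupType) (G N : {group gT}) (T : seq (gT * gT * nat))
    (I : finType) (A : {set I}) h :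
  (forall t, t \in T -> is_test G N t) -> (forall i, i \in A -> mult_cocycle G (h i)) ->
  exists A' : {set I}, [/\ A' \subset A, #|A| <= (\prod_(t <- T) t.2) * #|A'| &
    {in A' &, forall i j t, t \in T ->
       beta (h i) t.1.1 t.1.2 = beta (h j) t.1.1 t.1.2}].
Proof.
elim: T A => [|t T IH] A HT Zh.
  by exists A; split; rewrite ?big_nil ?mul1n.
have [] := IH A _ Zh; first by move=> s Ts; apply: HT; rewrite inE Ts orbT.
move=> A1 [sA1 cA1 eA1].
have [_ _ e0 He] := HT t (mem_head _ _).
have [z pz] := C_prim_root_exists e0.
have {He} HA1 i : exists k : 'I_t.2, i \in A1 -> beta (h i) t.1.1 t.1.2 = (z ^+ k)%R.
  have [A1i|] := boolP (i \in A1); last by exists (Ordinal e0).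
  have [k ek] := prim_rootP pz (He _ (Zh _ (subsetP sA1 _ A1i))).
  by exists k.
have {HA1} [c Hc] := fin_all_exists HA1.
have [A2 [sA2 cA2 eA2]] := pigeonhole A1 c; rewrite card_ord in cA2.
exists A2; split; first exact: subset_trans sA2 sA1.
  rewrite big_cons [(t.2 * _)%N]mulnC -mulnA.
  by apply: leq_trans cA1 _; rewrite leq_mul2l cA2 orbT.
move=> i j A2i A2j s; rewrite inE => /predU1P[->|Ts].
  by rewrite !Hc ?(subsetP sA2) // (eA2 i j).
by apply: eA1; rewrite ?(subsetP sA2).
Qed.

Lemma cocycle_quotient_eq (gT : finGroupType) (G N : {group gT}) f g :
  G \subset 'N(N) -> cohomologous (G / N) f g ->
  cohomologous G (fun x y => f (coset N x) (coset N y))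
                 (fun x y => g (coset N x) (coset N y)).
Proof. by move=> nNG; apply: (@cohom_pull _ _ _ G (coset N)). Qed.

(* Modulo N the members of a family with equal tests become inflations, and
   each inflated class comes from |N| classes of G / N, which differ by
   transgressions of the characters of N. *)
Lemma central_step (gT : finGroupType) (G N : {group gT}) (T : seq (gT * gT * nat)) c d :
  N \subset 'Z(G) -> N \subset G^`(1) ->
  (forall t, t \in T -> is_test G N t) ->
  (forall f, mult_cocycle G f ->
     (forall t, t \in T -> beta f t.1.1 t.1.2 = 1%R) ->
     forall n x, n \in N -> x \in G -> beta f n x = 1%R) ->
  mult_bound (G / N) c d -> mult_bound G (#|N| * c) (\prod_(t <- T) t.2 * d).
Proof.
move=> sNZ sND HT sepT bQ I A h [Zh hI].
have sNG : N \subset G := subset_trans sNZ (center_sub G).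
have nNG : G \subset 'N(N).
  by rewrite cents_norm // centsC; apply: subset_trans sNZ _; rewrite subsetIr.
have cNN : abelian N by apply: abelianS sNZ (center_abelian G).
have [A1 [sA1 cA1 eA1]] := equal_tests HT Zh.
suff: #|A1| * #|N| * c <= d.
  move=> le_d; apply: leq_trans (leq_mul (leqnn _) le_d).
  by have := leq_mul cA1 (leqnn (#|N| * c)); rewrite !mulnA.
have [->|[i0 A1i0]] := set_0Vmem A1; first by rewrite cards0 !mul0n.
pose inf (phi : coset_of N -> coset_of N -> algC) x y := phi (coset N x) (coset N y).
have Zh1 i : i \in A1 -> mult_cocycle G (h i) by move/(subsetP sA1)/Zh.
(* Division by the fixed member [h i0] turns equal test values into trivial ones, so each [q i] is
   inflated from some [phi i]. *)
pose q i := cocycle_mul (h i) (cocycle_inv (h i0)).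
have phiP i : exists phi, i \in A1 ->
    mult_cocycle (G / N) phi /\ cohomologous G (q i) (inf phi).
  have [A1i|] := boolP (i \in A1); last by exists (fun _ _ => 1%R).
  have Zq : mult_cocycle G (q i) by apply/cocycleM/cocycleV; apply: Zh1.
  have [|phi Zphi cphi] := cocycle_inflated sNZ Zq; last by exists phi.
  apply: sepT => // t Tt; have [Nt1 Gt2 _ _] := HT t Tt.
  rewrite beta_mul beta_inv (eA1 i i0) // divff // (beta_neq0 (Zh1 _ A1i0)) //.
  exact: subsetP sNG _ Nt1.
have {phiP} [phi phiP] := fin_all_exists phiP.
have chiP (k : Iirr N) := transgression sNZ
  (fun n Nn => lin_char_neq0 (char_abelianP _ cNN k) Nn) (lin_charM (char_abelianP _ cNN k)).
have {chiP} [psi psiP] := fin_all_exists chiP.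
have tauP k : exists tau, mult_cocycle (G / N) tau /\
    forall x y, x \in G -> y \in G ->
      inf tau x y = (psi k x * psi k y / psi k (x * y)%g)%R.
  by have [_ _ [tau Zt tE]] := psiP k; exists tau.
have {tauP} [tau tauP] := fin_all_exists tauP.
have inf_tau k f : cohomologous G (inf (cocycle_mul f (tau k))) (inf f).
  exists (psi k); split=> [|x y Gx Gy]; first by case: (psiP k).
  by rewrite /inf /cocycle_mul -/(inf (tau k) x y) (tauP k).2.
rewrite -mulnA -(card_Iirr_abelian cNN) mulnA -[#|Iirr N|]cardsT -cardsX.
(* Each [phi i] is twisted by the transgressions [tau k] of all characters of [N]. This yields
   [#|A1| * #|N|] classes of [G / N], whose independence remains to be shown. *)
apply: (bQ _ (setX A1 [set: Iirr N]) (fun u => cocycle_mul (phi u.1) (tau u.2))).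
split=> [[i k] /setXP[/= A1i _]|[i k] [j l] /setXP[/= A1i _] /setXP[/= A1j _] e].
  by apply: cocycleM; [exact: (phiP i A1i).1 | exact: (tauP k).1].
(* Inflation to [G] kills the factors [tau]. *)
have eij : i = j.
  apply: hI; rewrite ?(subsetP sA1) //; apply: (@cohom_divP _ _ _ _ (Zh1 _ A1j)).
  have ce := cohom_trans (cohom_sym (inf_tau k (phi i))) (cohom_trans
    (cocycle_quotient_eq nNG e) (inf_tau l (phi j))).
  have := cohom_trans (phiP i A1i).2 (cohom_trans ce (cohom_sym (phiP j A1j).2)).
  move/(fun H => cohom_mul H (cohom_refl G (cocycle_inv (q j)))) => H.
  apply: cohom_trans (cohom_trans _ H) _; apply: cohom_eq => x y Gx Gy;
    have h0 := (Zh1 _ A1i0).1 x y Gx Gy; have hj0 := (Zh1 _ A1j).1 x y Gx Gy;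
    rewrite /q /cocycle_mul /cocycle_inv ?/cocycle1; field; rewrite ?h0 ?hj0 //.
congr (_, _) => //; subst j.
have [f0 _] := (phiP i A1i).1.
have [w [w0 Hw]] := cohom_mul e (cohom_refl (G / N) (cocycle_inv (phi i))).
have GNx x : x \in G -> coset N x \in G / N by apply: mem_quotient.
have wE x y : x \in G -> y \in G -> inf (tau k) x y =
    (inf (tau l) x y * (w (coset N x) * w (coset N y) / w (coset N (x * y))))%R.
  move=> Gx Gy; have := Hw _ _ (GNx x Gx) (GNx y Gy).
  have := f0 _ _ (GNx x Gx) (GNx y Gy).
  rewrite -morphM ?(subsetP nNG) // /inf /cocycle_mul /cocycle_inv /=.
  by set a := phi _ _ _ => a0; rewrite ![(a * _)%R]mulrC !mulfK.
have [psik0 psikM _] := psiP k; have [psil0 psilM _] := psiP l.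
(* Here [tau k] and [tau l] differ by the coboundary of [w], so [u] is a homomorphism on [G]; it is
   trivial on [N], which lies in the derived subgroup. *)
pose u x := (psi k x / (psi l x * w (coset N x)))%R.
have u0 x : x \in G -> u x != 0%R.
  by move=> Gx; rewrite !(mulf_neq0, invr_neq0) ?psik0 ?psil0 ?w0 ?GNx.
have uM x y : x \in G -> y \in G -> u (x * y) = (u x * u y)%R.
  move=> Gx Gy; have Gxy := groupM Gx Gy; have := wE x y Gx Gy.
  rewrite (tauP k).2 // (tauP l).2 // /u => H.
  have -> : psi k (x * y) = (psi k x * psi k y / (psi k x * psi k y / psi k (x * y)%g))%R.
    by field; rewrite ?psik0.
  by rewrite H; field; rewrite ?psik0 ?psil0 ?w0 ?GNx.
have u1 x : x \in N -> u x = 1%R.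
  by move=> /(subsetP sND); apply: (mult_hom_der1 u0 uM).
apply: irr_inj; apply/cfun_inP => n Nn.
have G1 := group1 G; have Gn := subsetP sNG _ Nn.
(* Comparing [u n] with [u 1] cancels the values at 1 and leaves ['chi_k n = 'chi_l n]. *)
have := u1 n Nn; rewrite -(u1 1 (group1 N)) /u -{1 2}[n]mulg1 psikM // psilM //.
rewrite coset_id // morph1 => /(congr1 (fun a => a * (psi l 1%g * w 1%g / psi k 1%g))%R).
have := w0 _ (group1 _); have := psik0 _ G1; have := psil0 _ G1.
have := lin_char_neq0 (char_abelianP _ cNN l) Nn.
move=> c0 p0 p1 w10 H.
apply: (mulIf (invr_neq0 c0)); rewrite divff //.
move: H; rewrite -/(w 1%g) => H.
transitivity ('chi_k n * psi k 1%g / ('chi_l n * psi l 1%g * w 1%g) *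
   (psi l 1%g * w 1%g / psi k 1%g))%R; first by field; rewrite c0 p0 p1 w10.
by rewrite H; field; rewrite p0 p1 w10.
Qed.

(** * Sylow subgroups, abelian groups and central chains *)

Lemma beta_test (gT : finGroupType) (G : {group gT}) f x y k :
  mult_cocycle G f -> x \in G -> y \in G -> commute x y -> x ^+ k = 1 ->
  (beta f x y ^+ k = 1)%R.
Proof.
move=> Zf Gx Gy c xk; rewrite -(betaX Zf) // xk (betaV f Gy) //.
by rewrite (beta1r Zf Gy) invr1.
Qed.

(** * Reduction to Sylow subgroups *)

Section SylowReduction.
Variables (gT : finGroupType) (G : {group gT}).

Lemma cohom1_gcd f a b : mult_cocycle G f ->
  cohomologous G (cocycle_exp f a) (@cocycle1 gT) ->
  cohomologous G (cocycle_exp f b) (@cocycle1 gT) ->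
  cohomologous G (cocycle_exp f (gcdn a b)) (@cocycle1 gT).
Proof.
move=> [f0 _] ca cb; case: (posnP a) => [->|a0]; first by rewrite gcd0n.
have [u _ /dvdnP[v e]] := Bezoutl b a0.
have H := cohom_mul (cohom_exp v ca) (cohom_inv (cohom_exp u cb)).
apply: cohom_trans (cohom_trans _ H) _; apply: cohom_eq => x y Gx Gy;
  rewrite /cocycle_mul /cocycle_inv /cocycle_exp.
  apply: (mulIf (expf_neq0 (u * b) (f0 x y Gx Gy))).
  rewrite -exprD e -!exprM [(b * u)%N]mulnC mulfVK ?expf_neq0 ?f0 //.
  by rewrite mulnC.
by rewrite /cocycle1 !expr1n invr1 mulr1.
Qed.

(** By transfer the class is killed by every index [#|G : S p|], and by Bezout also by their
    greatest common divisor, which is 1. *)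
Lemma cohom_sylow (S : nat -> {group gT}) f :
  (forall p, p \in primes #|G| -> S p \in 'Syl_p(G)) -> mult_cocycle G f ->
  (forall p, p \in primes #|G| -> cohomologous (S p) f (@cocycle1 gT)) ->
  cohomologous G f (@cocycle1 gT).
Proof.
move=> sylS Zf cS.
(* The initial value [#|G|] is the index of the trivial subgroup, so transfer covers it too; it also
   ensures that [d] divides [#|G|]. *)
pose d := \big[gcdn/#|G|]_(p <- primes #|G| | p \in primes #|G|) #|G : S p|.
have cd : cohomologous G (cocycle_exp f d) (@cocycle1 gT).
  rewrite /d; apply: (big_ind (fun k => cohomologous G (cocycle_exp f k) (@cocycle1 gT)))
    => [|a b ca cb|p Pp].
  - have := @cohom_transfer _ G 1%G (sub1G G) _ Zf; rewrite indexg1; apply.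
    apply: (@symmetric_cocycle _ 1%G _ (abelian1 _) (cocycleS (sub1G G) Zf)).
    by move=> x y /set1P-> /set1P->.
  - exact: cohom1_gcd.
  - have := sylS p Pp; rewrite inE => sylSp.
    exact: (cohom_transfer (pHall_sub sylSp) Zf (cS p Pp)).
have dvd_d q : q %| d -> (q %| #|G|) && all (fun p => q %| #|G : S p|) (primes #|G|).
  rewrite /d -big_seq; elim: (primes #|G|) => [|p r IH]; first by rewrite big_nil andbT.
  by rewrite big_cons dvdn_gcd /= => /andP[-> /IH].
suff d1 : d = 1%N.
  by apply: cohom_trans cd; rewrite d1; apply: cohom_eq => x y _ _; rewrite /cocycle_exp expr1.
apply: contraTeq isT => d1.
have d0 : 0 < d.
  have [d0|//] := posnP d; have := dvd_d 0; rewrite d0 => /(_ isT)/andP[].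
  by rewrite dvd0n => /eqP G0; have := cardG_gt0 G; rewrite G0.
have q_pr : prime (pdiv d) by rewrite pdiv_prime // ltn_neqAle eq_sym d1.
have /andP[qG /allP qS] := dvd_d _ (pdiv_dvd d).
have Pq : pdiv d \in primes #|G| by rewrite mem_primes q_pr cardG_gt0.
have := sylS _ Pq; rewrite inE => /and3P[_ _].
by rewrite p'natE // qS.
Qed.

(** A class is determined by its restrictions to the Sylow subgroups; the pigeonhole principle fixes
    these one prime at a time. *)
Lemma mult_bound_sylow (S : nat -> {group gT}) (m : nat -> nat) :
  (forall p, p \in primes #|G| -> S p \in 'Syl_p(G)) ->
  (forall p, p \in primes #|G| -> mult_bound (S p) 1 (m p)) ->
  mult_bound G 1 (\prod_(p <- primes #|G|) m p).
Proof.
move=> sylS bS I A h [Zh hI]; rewrite muln1.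
have sSG p : p \in primes #|G| -> S p \subset G.
  by move/sylS; rewrite inE; apply: pHall_sub.
have key (r : seq nat) : {subset r <= primes #|G|} ->
    exists A' : {set I}, [/\ A' \subset A, #|A| <= (\prod_(p <- r) m p) * #|A'| &
    {in A' &, forall i j p, p \in r -> cohomologous (S p) (h i) (h j)}].
  elim: r => [_|p r IH sr]; first by exists A; rewrite big_nil mul1n.
  have [|A1 [sA1 cA1 eA1]] := IH; first by move=> q rq; apply: sr; rewrite inE rq orbT.
  have [A10|[i0 A1i0]] := set_0Vmem A1.
    exists set0; split; rewrite ?sub0set //; last by move=> i j; rewrite inE.
    by move: cA1; rewrite A10 !cards0 !muln0.
  have Pp : p \in primes #|G| by apply: sr; rewrite mem_head.
  have [mp le_mp [rep Hrep]] := max_indep (bS p Pp).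
  have Zi i : i \in A1 -> mult_cocycle (S p) (h i).
    by move=> /(subsetP sA1)/Zh; apply: cocycleS (sSG p Pp).
  have [k0 _] := Hrep _ (Zi _ A1i0).
  have cP i : exists k : 'I_mp, i \in A1 -> cohomologous (S p) (h i) (rep k).
    have [/Zi/Hrep[k ck]|_] := boolP (i \in A1); last by exists k0.
    by exists k.
  have [c {}cP] := fin_all_exists cP.
  have [A2 [sA2 cA2 eA2]] := pigeonhole A1 c; rewrite card_ord in cA2.
  exists A2; split; first exact: subset_trans sA2 sA1.
    rewrite big_cons [(m p * _)%N]mulnC -mulnA; apply: leq_trans cA1 _.
    by rewrite leq_mul // (leq_trans cA2) // leq_mul.
  move=> i j A2i A2j q; have [A1i A1j] := (subsetP sA2 _ A2i, subsetP sA2 _ A2j).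
  rewrite inE => /predU1P[->|rq]; last exact: eA1.
  by apply: cohom_trans (cP i A1i) _; rewrite (eA2 i j) //; apply: cohom_sym (cP j A1j).
have [A1 [sA1 cA1 eA1]] := key _ (fun p => id).
apply: leq_trans cA1 _; rewrite -[X in _ <= X]muln1 leq_mul2l; apply/orP; right.
apply/card_le1_eqP => i j A1i A1j.
have [Ai Aj] := (subsetP sA1 _ A1i, subsetP sA1 _ A1j).
apply: hI => //; apply: (@cohom_divP _ _ _ _ (Zh i Ai)); apply: cohom_sylow sylS _ _.
  by apply/cocycleM/cocycleV; apply: Zh.
move=> p Pp; apply: cohom_div; first exact: cocycleS (sSG p Pp) (Zh i Ai).
exact: eA1.
Qed.

End SylowReduction.

(** * Abelian groups and alternating bicharacters *)

Fixpoint pair_tests (gT : finGroupType) (b : seq gT) : seq (gT * gT * nat) :=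
  if b is x :: b' then [seq (x, y, minn #[x] #[y]) | y <- b'] ++ pair_tests b' else [::].


(** The exponent at a pair is the smaller of two orders, so its square is at most their product, and
    each entry of [b] occurs in [(size b).-1] pairs. *)
Lemma pair_tests_card (gT : finGroupType) (b : seq gT) :
  (\prod_(t <- pair_tests b) t.2) ^ 2 <= (\prod_(x <- b) #[x]) ^ (size b).-1.
Proof.
elim: b => [|x b IH] /=; first by rewrite !big_nil.
rewrite big_cat big_map big_cons /= !expnMn -/(pair_tests _).
have {}IH : (\prod_(t <- pair_tests b) t.2) ^ 2 * \prod_(y <- b) #[y] <=
    (\prod_(y <- b) #[y]) ^ size b.
  case: b IH => [|y b] IH; first by rewrite !big_nil.
  by rewrite /= [(_ ^ (size b).+1)%N]expnS mulnC leq_mul2l IH orbT.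
suff le : (\prod_(y <- b) minn #[x] #[y]) ^ 2 <= #[x] ^ size b * \prod_(y <- b) #[y].
  apply: leq_trans (leq_mul le (leqnn _)) _; rewrite -mulnA leq_mul2l; apply/orP; right.
  by rewrite mulnC.
elim: b {IH} => [|y b IH]; first by rewrite !big_nil.
rewrite !big_cons expnMn /= [(#[x] ^ (size b).+1)%N]expnS mulnACA leq_mul //.
by rewrite -mulnn leq_mul ?geq_minl ?geq_minr.
Qed.

Lemma pair_testsP (gT : finGroupType) (G : {group gT}) (b : seq gT) :
  abelian G -> {subset b <= G} ->
  (forall t, t \in pair_tests b -> is_test G G t) /\
  (forall f, mult_cocycle G f ->
     (forall t, t \in pair_tests b -> beta f t.1.1 t.1.2 = 1%R) ->
     {in b &, forall x y, beta f x y = 1%R}).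
Proof.
move=> cGG; elim: b => [|x b IH] sbG; first by split.
have Gx : x \in G by apply: sbG; rewrite mem_head.
have [|IH1 IH2] := IH; first by move=> y by_; apply: sbG; rewrite inE by_ orbT.
have Gb y : y \in b -> y \in G by move=> by_; apply: sbG; rewrite inE by_ orbT.
split=> [t|f Zf /= Hf].
  rewrite /= mem_cat => /orP[/mapP[y /Gb Gy ->]|/IH1 //].
  have cxy := centsP cGG x Gx y Gy; split; rewrite //= ?leq_min ?order_gt0 // => f Zf.
  case: leqP => _; first by apply: beta_test Zf _ _ _ (expg_order _).
  rewrite (betaV f Gy) // exprVn (beta_test Zf) ?invr1 ?expg_order //.
have Hb y : y \in b -> beta f x y = 1%R.
  by move=> by_; apply: (Hf (x, y, _)); rewrite mem_cat; apply/orP; left; apply: map_f.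
have Hbb := IH2 f Zf (fun t Tt => Hf t (etrans (mem_cat _ _ _) (introT orP (or_intror Tt)))).
move=> y z; rewrite !inE => /predU1P[->|by_] /predU1P[->|bz].
- exact: (betaxx Zf).
- exact: Hb.
- by rewrite (betaV f Gx) ?Gb // Hb // invr1.
- exact: Hbb.
Qed.

(** Tests on the pairs of a basis determine the whole pairing, and a cocycle with trivial pairing is
    symmetric, hence a coboundary. The basis has ['r(A)] elements. *)
Lemma mult_bound_abelian (gT : finGroupType) (A : {group gT}) : abelian A ->
  exists2 q, mult_bound A 1 q & q ^ 2 <= #|A| ^ ('r(A)).-1.
Proof.
move=> cAA; have [b defA ordb] := abelian_structure cAA.
have cardA := bigdprod_card defA.
have sbA : {subset b <= A}.
  move=> x bx; rewrite -(bigdprodWY defA); apply: mem_gen.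
  rewrite (big_rem x bx) /=; apply/setUP; left; exact: cycle_id.
have genA x : x \in A -> x \in <<[set x in b]>>.
  apply: subsetP; rewrite -{1}(bigdprodWY defA) gen_subG.
  rewrite big_seq.
  apply: (big_ind (fun B : {set gT} => B \subset _)) => [|B C sB sC|y bby].
  - exact: sub0set.
  - by rewrite subUset sB.
  - by rewrite cycle_subG mem_gen // inE.
have sAb : [set x in b] \subset A by apply/subsetP=> x; rewrite inE => /sbA.
have [testb sepb] := pair_testsP cAA sbA.
exists (\prod_(t <- pair_tests b) t.2)%N; last first.
  apply: leq_trans (pair_tests_card b) _.
  by rewrite -cardA -(size_abelian_type cAA) -ordb size_map.
move=> I B h [Zh hI]; rewrite muln1.
have [B1 [sB1 cB1 eB1]] := equal_tests testb Zh.
apply: leq_trans cB1 _; rewrite -[X in _ <= X]muln1 leq_mul2l; apply/orP; right.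
apply/card_le1_eqP => i j B1i B1j.
have [Bi Bj] := (subsetP sB1 _ B1i, subsetP sB1 _ B1j).
apply: hI => //; apply: (@cohom_divP _ _ _ _ (Zh i Bi)).
have Zf := cocycleM (Zh j Bj) (cocycleV (Zh i Bi)).
set f := cocycle_mul _ _ in Zf *.
have cA x y : x \in A -> y \in A -> commute x y by move=> Ax Ay; apply: (centsP cAA).
have bb : {in b &, forall x y, beta f x y = 1%R}.
  apply: sepb => // t Tt; rewrite beta_mul beta_inv (eB1 j i) // divff //.
  by have [Gt1 Gt2 _ _] := testb t Tt; apply: (beta_neq0 (Zh i Bi)).
have bA x y : x \in b -> y \in A -> beta f x y = 1%R.
  move=> bx /genA; apply: (@mult_hom_gen _ A) => //; last first.
  - by move=> z; rewrite inE => bz; apply: bb.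
  - by move=> z w Az Aw; apply: (betaMr Zf) => //; [apply: sbA|apply: cA => //; apply: sbA|apply: cA => //; apply: sbA].
  - by move=> z Az; apply: (beta_neq0 Zf) => //; apply: sbA.
have AA x y : x \in A -> y \in A -> beta f x y = 1%R.
  move=> Ax /genA; apply: (@mult_hom_gen _ A) => //; last first.
  - by move=> z; rewrite inE => bz; rewrite (betaV f (sbA z bz)) // bA ?invr1.
  - by move=> z w Az Aw; apply: (betaMr Zf) => //; apply: cA.
  - by move=> z Az; apply: (beta_neq0 Zf).
apply: symmetric_cocycle => // x y Ax Ay.
have /(congr1 (fun a => a * f y x)%R) := AA x y Ax Ay.
by rewrite mul1r /beta mulfVK // Zf.1.
Qed.

(** * Chains of central subgroups of order p *)

Lemma mult_bound_leq (gT : finGroupType) (G : {set gT}) c d d' :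
  d <= d' -> mult_bound G c d -> mult_bound G c d'.
Proof. by move=> le_d b I A h /b le; apply: leq_trans le le_d. Qed.

(** Since [x] lies in the derived subgroup, its pairing with the center is trivial. Only the values
    at the elements of [X] are free, with [p] choices each. *)
Lemma mult_bound_cycle (gT : finGroupType) (G : {group gT}) (X : {set gT}) p x c d :
  prime p -> #[x] = p -> x \in 'Z(G) -> x \in G^`(1) -> X <*> 'Z(G) = G ->
  mult_bound (G / <[x]>) c d -> mult_bound G (p * c) (p ^ #|X| * d).
Proof.
move=> p_pr ox Zx Dx defG bQ.
have /centerP[Gx cx] := Zx.
have sXG : X \subset G by rewrite -defG joingE sub_gen ?subsetUl.
pose T := [seq (x, y, p) | y <- enum X].
have prodT : (\prod_(t <- T) t.2 = p ^ #|X|)%N.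
  by rewrite big_map big_enum prod_nat_const.
rewrite -prodT -ox; apply: central_step => //; rewrite ?cycle_subG //.
  move=> _ /mapP[y Xy ->]; rewrite mem_enum in Xy; have Gy := subsetP sXG _ Xy.
  split; rewrite //= ?cycle_id ?prime_gt0 // => f Zf.
  by apply: (beta_test Zf) => //; [exact: cx | rewrite -ox expg_order].
move=> f Zf Hf n g /cycleP[k ->] Gg; rewrite (betaX Zf) //; last exact: cx.
suff -> : beta f x g = 1%R by rewrite expr1n.
have := Gg; rewrite -{1}defG; apply: (@mult_hom_gen _ G); last first.
- move=> y /setUP[Xy|Zy].
    by apply: (Hf (x, y, p)); apply: map_f; rewrite mem_enum.
  have Gy := subsetP (center_sub G) _ Zy.
  by rewrite (betaV f Gy) // (beta_center_der1 Zf) ?invr1.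
- by rewrite subUset sXG center_sub.
- by move=> y z Gy Gz; apply: (betaMr Zf) => //; exact: cx.
by move=> y Gy; apply: (beta_neq0 Zf).
Qed.

(** Induction on [#|L|]: the quotient by a subgroup of order [p] in [L :&: 'Z(G)] is handled by
    [mult_bound_cycle]. *)
Lemma mult_bound_chain p (gT : finGroupType) (G L : {group gT}) (X : {set gT}) c d :
  prime p -> p.-group G -> L <| G -> L \subset G^`(1) -> X <*> 'Z(G) = G ->
  mult_bound (G / L) c d -> mult_bound G (#|L| * c) (#|L| ^ #|X| * d).
Proof.
move=> p_pr; have [m] := ubnP #|L|; elim: m => // m IH in gT G L X c d *.
rewrite ltnS => leL pG nLG sLD defG bQ.
have sXG : X \subset G by rewrite -defG joingE sub_gen ?subsetUl.
have [L1|ntL] := eqVneq (L : {set gT}) 1.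
  move: bQ; rewrite L1 cards1 exp1n !mul1n; apply: mult_bound_isog.
  exact: quotient1_isog.
have ntLZ := meet_center_nil (pgroup_nil pG) nLG ntL.
have sLZG : L :&: 'Z(G) \subset G by rewrite subIset // center_sub orbT.
have [_ p_dv _] := pgroup_pdiv (pgroupS sLZG pG) ntLZ.
have [x /setIP[Lx Zx] ox] := Cauchy p_pr p_dv.
have Dx := subsetP sLD _ Lx.
have sNL : <[x]> \subset L by rewrite cycle_subG.
have nNG : <[x]> <| G by apply: sub_center_normal; rewrite cycle_subG.
have cardL : (#|L| = p * #|L / <[x]>|)%N.
  by rewrite -ox -(Lagrange sNL) card_quotient // (subset_trans (normal_sub nLG)) ?normal_norm.
have ltL : #|L / <[x]>| < m.
  apply: leq_trans leL; rewrite cardL ltn_Pmull ?prime_gt1 ?cardG_gt0 //.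
have sXN : X \subset 'N(<[x]>) := subset_trans sXG (normal_norm nNG).
have sZN : 'Z(G) \subset 'N(<[x]>) := subset_trans (center_sub G) (normal_norm nNG).
(* The generation hypothesis survives because the image of the center is central in the quotient. *)
have defQ : (X / <[x]>) <*> 'Z(G / <[x]>) = (G / <[x]>)%G.
  apply/eqP; rewrite eqEsubset join_subG quotientS ?center_sub //=.
  by rewrite -{1}defG quotientY // genS // setUS // morphim_center.
have bQQ : mult_bound ((G / <[x]>) / (L / <[x]>)) c d.
  exact: mult_bound_isog (third_isog sNL nNG nLG) bQ.
have := IH _ (G / <[x]>)%G (L / <[x]>)%G (X / <[x]>) c d ltL
  (quotient_pgroup _ pG) (quotient_normal _ nLG) _ defQ bQQ.
rewrite /= -quotient_der ?normal_norm // quotientS // => /(_ isT) bN.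
rewrite cardL -mulnA expnMn -mulnA; apply: (mult_bound_cycle p_pr ox Zx Dx defG).
apply: mult_bound_leq bN; rewrite leq_mul2r leq_pexp2l ?orbT ?cardG_gt0 //.
exact: leq_quotient.
Qed.

(** * Groups of class two *)

Section Jacobi.
Variables (gT : finGroupType) (G : {group gT}) (f : gT -> gT -> algC).
Hypothesis Zf : mult_cocycle G f.
Hypothesis class2 : G^`(1) \subset 'Z(G).

(* Left multiplication by the basis element u_x of the twisted group algebra,
   on scalar multiples (y, a) = a u_y of basis elements. *)
Let act x (q : gT * algC) : gT * algC := (x * q.1, (f x q.1 * q.2)%R).
Let scale c (q : gT * algC) : gT * algC := (q.1, (c * q.2)%R).

Let act_scale x c q : act x (scale c q) = scale c (act x q).
Proof. by rewrite /act /scale /=; congr (_, _); rewrite mulrCA. Qed.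

Let scaleM c d q : scale c (scale d q) = scale (c * d)%R q.
Proof. by rewrite /scale /= mulrA. Qed.

Let actG x q : x \in G -> q.1 \in G -> (act x q).1 \in G.
Proof. exact: groupM. Qed.

Let act0 x q : x \in G -> q.1 \in G -> q.2 != 0%R -> (act x q).2 != 0%R.
Proof. by move=> Gx Gq q0; rewrite mulf_neq0 ?Zf.1. Qed.

Let actM x y q : x \in G -> y \in G -> q.1 \in G ->
  act x (act y q) = scale (f x y) (act (x * y) q).
Proof.
move=> Gx Gy Gq; rewrite /act /scale /= mulgA; congr (_, _).
by rewrite !mulrA Zf.2 // [(f x _ * _)%R]mulrC.
Qed.

(** The scalar in the relation [u_x u_y = c u_y u_x u_[x, y]]. *)
Let c x y := (f x y / (f y x * f (y * x)%g [~ x, y]))%R.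

Let swap x y q : x \in G -> y \in G -> q.1 \in G ->
  act x (act y q) = scale (c x y) (act y (act x (act [~ x, y] q))).
Proof.
move=> Gx Gy Gq; have Gw : [~ x, y] \in G by rewrite groupR.
have Gyx := groupM Gy Gx.
rewrite (actM Gy Gx) ?actG // (actM Gyx Gw) // (actM Gx Gy) // !scaleM -commgC.
by congr (scale _ _); rewrite /c; field; rewrite !Zf.1.
Qed.

Let swapC x y q : x \in G -> y \in G -> q.1 \in G -> commute x y ->
  act x (act y q) = scale (beta f x y) (act y (act x q)).
Proof.
move=> Gx Gy Gq cxy.
rewrite (actM Gx Gy) // (actM Gy Gx) // scaleM cxy.
by congr (scale _ _); rewrite /beta; field; rewrite !Zf.1.
Qed.

(* Compare the two ways of reversing u_x u_y u_z by adjacent swaps. *)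
Lemma beta_jacobi x y z : x \in G -> y \in G -> z \in G ->
  (beta f [~ x, y] z * beta f [~ y, z] x = beta f [~ x, z] y)%R.
Proof.
move=> Gx Gy Gz.
have D a b : a \in G -> b \in G -> [~ a, b] \in G^`(1).
  by move=> Ga Gb; rewrite derg1 mem_commg.
have GD w : w \in G^`(1) -> w \in G by apply/subsetP/der_sub.
have cD w a : w \in G^`(1) -> a \in G -> commute w a.
  by move=> /(subsetP class2)/centerP[_ cw] /cw.
have swapD v w q : v \in G^`(1) -> w \in G^`(1) -> q.1 \in G ->
    act v (act w q) = act w (act v q).
  move=> Dv Dw Gq; rewrite (swapC (GD _ Dv) (GD _ Dw)) //; last by apply: cD; rewrite ?GD.
  rewrite (beta_center_der1 Zf) ?(subsetP class2) //.
  by rewrite /scale mul1r; case: (act w _).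
have swapG w a q : w \in G^`(1) -> a \in G -> q.1 \in G ->
    act w (act a q) = scale (beta f w a) (act a (act w q)).
  by move=> Dw Ga Gq; apply: swapC => //; [exact: GD | exact: cD].
have [Dxy Dyz Dxz] := And3 (D _ _ Gx Gy) (D _ _ Gy Gz) (D _ _ Gx Gz).
have [Gxy Gyz Gxz] := And3 (GD _ Dxy) (GD _ Dyz) (GD _ Dxz).
pose q : gT * algC := (1, 1%R); have Gq : q.1 \in G by exact: group1.
pose Q := act z (act y (act x (act [~ y, z] (act [~ x, z] (act [~ x, y] q))))).
have W1 : act x (act y (act z q)) =
    scale (c x y * (beta f [~ x, y] z * (c x z * (c y z * beta f [~ y, z] x)))) Q.
  rewrite (swap Gx Gy) ?actG // (swapG _ _ _ Dxy Gz) //.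
  rewrite !act_scale (swap Gx Gz) ?actG // !act_scale (swap Gy Gz) ?actG //.
  by rewrite (swapG _ _ _ Dyz Gx) ?actG // !act_scale !scaleM !mulrA.
have W2 : act x (act y (act z q)) =
    scale (c y z * (c x z * (beta f [~ x, z] y * c x y))) Q.
  rewrite (swap Gy Gz) // act_scale (swap Gx Gz) ?actG // (swapG _ _ _ Dxz Gy) ?actG //.
  rewrite !act_scale (swap Gx Gy) ?actG // !act_scale !scaleM !mulrA /Q.
  rewrite (swapD [~ x, z] [~ y, z]) // (swapD [~ x, y] [~ y, z]) ?actG //.
  by rewrite (swapD [~ x, y] [~ x, z]).
have Q0 : Q.2 != 0%R by rewrite /Q !act0 ?actG ?oner_neq0.
have c0 a b : a \in G -> b \in G -> c a b != 0%R.
  move=> Ga Gb; have Gab := GD _ (D _ _ Ga Gb); have Gba := groupM Gb Ga.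
  by rewrite /c mulf_neq0 ?invr_neq0 ?mulf_neq0 ?Zf.1.
have := W1; rewrite W2 /scale => -[] /(mulIf Q0) e.
(* Both reversals pick up the same three factors [c], which cancel. *)
apply: (mulfI (mulf_neq0 (mulf_neq0 (c0 _ _ Gx Gy) (c0 _ _ Gx Gz)) (c0 _ _ Gy Gz))).
transitivity (c x y * (beta f [~ x, y] z * (c x z * (c y z * beta f [~ y, z] x))))%R.
  by ring.
by rewrite -e; ring.
Qed.

End Jacobi.

(** * A greedy basis of the derived subgroup and the independent Jacobi relations *)

Section ClassTwo.
Variables (gT : finGroupType) (G : {group gT}) (p D : nat) (y : 'I_D -> gT).
Hypothesis p_pr : prime p.
Hypothesis pG : p.-group G.
Hypothesis class2 : G^`(1) \subset 'Z(G).
Hypothesis expG' : forall w, w \in G^`(1) -> w ^+ p = 1.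
Hypothesis defG : [set y i | i : 'I_D] <*> 'Z(G) = G.

Implicit Types (b e : {set 'I_D}) (i j l : 'I_D) (n : nat).

(* The commutator attached to an unordered pair, up to inversion. *)
Let wof e := if [pick u : 'I_D * 'I_D | (u.1 != u.2) && (e == [set u.1; u.2])] is Some u
  then [~ y u.1, y u.2] else 1.

Let Gy i : y i \in G.
Proof. by rewrite -defG joingE mem_gen // inE imset_f. Qed.

Let wofE i j : i != j ->
  wof [set i; j] = [~ y i, y j] \/ [~ y i, y j] = (wof [set i; j])^-1.
Proof.
move=> ij; rewrite /wof; case: pickP => [[k l] /= /andP[kl /eqP e]|/(_ (i, j))].
  have ki : k \in [set i; j] by rewrite e !inE eqxx.
  have : l \in [set i; j] by rewrite e !inE eqxx orbT.
  move: ki kl; rewrite !inE => /pred2P[]-> kl /pred2P[]l_ij; rewrite l_ij ?eqxx // in kl *.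
    by left.
  by right; rewrite invg_comm.
by rewrite /= ij eqxx.
Qed.

Let wofD e : wof e \in G^`(1).
Proof.
by rewrite /wof; case: pickP => [u _|_]; rewrite ?group1 // derg1 mem_commg.
Qed.

(** [V n] is spanned by the commutators of pairs of code below [n]. The greedy basis [B] keeps a
    pair when its commutator is not spanned by those of smaller pairs. *)
Let V n := <<[set wof e | e in [set e : {set 'I_D} | #|e| == 2 & code e < n]]>>.
Let B := [set e : {set 'I_D} | (#|e| == 2) && (wof e \notin V (code e))].
Let VB n := <<[set wof e | e in [set e in B | code e < n]]>>.

Let V_VB n : V n \subset VB n.
Proof.
elim/ltn_ind: n => n IH; rewrite gen_subG; apply/subsetP=> _ /imsetP[e Pe ->].
move: Pe; rewrite inE => /andP[e2 en]; have [eB|eB] := boolP (e \in B).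
  by apply: mem_gen; apply: imset_f; rewrite inE eB.
have Ve : wof e \in V (code e) by move: eB; rewrite inE e2 negbK.
apply: subsetP (subsetP (IH _ en) _ Ve); apply: genS; apply: imsetS.
by apply/subsetP=> b; rewrite !inE => /andP[-> be]; rewrite (ltn_trans be en).
Qed.

Let sVD n : V n \subset G^`(1).
Proof. by rewrite gen_subG; apply/subsetP=> _ /imsetP[e _ ->]; apply: wofD. Qed.

Let codeB e : code e < 2 ^ D.
Proof. by apply: code_lt => i _; apply: ltn_ord. Qed.

Let memB n e : (e \in [set b in B | code b < n]) = (e \in B) && (code e < n).
Proof. by rewrite in_set. Qed.

(** Codes are injective, so at most one basis pair enters at each step, and it enlarges [V]
    strictly, hence by an index of at least [p]. *)
Let card_B n : p ^ #|[set b in B | code b < n]| <= #|V n|.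
Proof.
elim: n => [|n IH].
  rewrite (_ : [set _ in _ | _] = set0) ?cards0 ?cardG_gt0 //.
  by apply/setP=> b; rewrite !inE ltn0 andbF.
have sV : V n \subset V n.+1.
  apply: genS; apply: imsetS; apply/subsetP=> b; rewrite !inE => /andP[-> bn].
  exact: ltnW.
have [/existsP[b /andP[bB /eqP bn]]|/existsPn nb] := boolP [exists b in B, code b == n].
  have -> : [set b in B | code b < n.+1] = b |: [set b in B | code b < n].
    apply/setP=> e; rewrite in_setU1 !memB ltnS leq_eqVlt -bn (inj_eq (@code_inj D)).
    by case: eqP => [->|]; rewrite ?bB.
  rewrite cardsU1 memB bn ltnn andbF expnS.
  have nV : 1 < #|V n.+1 : V n|.
    rewrite indexg_gt1; apply/subsetPn; exists (wof b).
      by apply: mem_gen; apply: imset_f; move: bB; rewrite !inE bn leqnn => /andP[-> _].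
    by move: bB; rewrite inE bn => /andP[].
  rewrite -(Lagrange sV) mulnC leq_mul //.
  have pV : p.-group (V n.+1) := pgroupS (subset_trans (sVD _) (der_sub 1 G)) pG.
  have /p_natP[[|k] e] : p.-nat #|V n.+1 : V n| by exact: pnat_dvd (dvdn_indexg _ _) pV.
    by move: nV; rewrite e.
  by rewrite e expnS leq_pmulr ?expn_gt0 ?prime_gt0.
apply: leq_trans (subset_leq_card sV); apply: leq_trans IH; apply: eq_leq.
congr (_ ^ _)%N; apply: eq_card => e; rewrite !memB ltnS leq_eqVlt.
by have := nb e; case: (e \in B) => //= /negPf->.
Qed.

Let cZ w x : w \in G^`(1) -> x \in G -> commute w x.
Proof. by move=> /(subsetP class2)/centerP[_ cw] /cw. Qed.

Let GD w : w \in G^`(1) -> w \in G.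
Proof. exact/subsetP/der_sub. Qed.

Let VBT := VB (2 ^ D).

(** Modulo [VBT] the generators [y i] and the center commute pairwise, so the quotient is
    abelian. *)
Let der1_VB : G^`(1) = VBT.
Proof.
have sVB : VBT \subset G^`(1).
  by rewrite gen_subG; apply/subsetP=> _ /imsetP[e _ ->]; apply: wofD.
apply/eqP; rewrite eqEsubset sVB andbT.
have nVB : G \subset 'N(VBT).
  by rewrite cents_norm // centsC (subset_trans (subset_trans sVB class2)) ?subsetIr.
apply: der1_min => //.
have sYG : [set y i | i : 'I_D] :|: 'Z(G) \subset G.
  by rewrite subUset center_sub andbT; apply/subsetP=> _ /imsetP[i _ ->].
rewrite -{1}defG joingE quotient_gen ?(subset_trans sYG) // abelian_gen.
apply: quotient_cents2r; rewrite gen_subG; apply/subsetP=> _ /imset2P[a b Ha Hb ->].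
have ZR z x : z \in 'Z(G) -> x \in G -> [~ z, x] = 1 /\ [~ x, z] = 1.
  move=> /centerP[_ cz] Gx; split; apply/eqP/commgP; last apply: commute_sym; exact: cz.
have [Gb Ga] := (subsetP sYG _ Hb, subsetP sYG _ Ha).
case/setUP: Ha => [/imsetP[i _ ea]|Za]; last by rewrite (ZR a b Za Gb).1 group1.
case/setUP: Hb => [/imsetP[j _ eb]|Zb]; last by rewrite (ZR b a Zb Ga).2 group1.
rewrite ea eb; have [->|ij] := eqVneq i j; first by rewrite commgg group1.
have Vij : wof [set i; j] \in VBT.
  apply: (subsetP (V_VB _)); apply: mem_gen; apply: imset_f.
  by rewrite inE cards2 ij codeB.
by case: (wofE ij) => [<-//|->]; rewrite groupV.
Qed.

(* One value per triple having a face in B: the one determined by its relation. *)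
Let NF := [set u : {set 'I_D} * 'I_D | [&& u.1 \in B, u.2 \notin u.1 &
  [pick l in u.2 |: u.1 | (u.2 |: u.1) :\ l \in B] == Some u.2]].
Let free := setX B [set: 'I_D] :\: NF.

(* By induction on the code of b + {l}: of the three terms of the Jacobi relation
   for this triple, the two others are free or spanned by smaller ones. *)
Let elimination f : mult_cocycle G f ->
  (forall u, u \in free -> beta f (wof u.1) (y u.2) = 1%R) ->
  forall n b l, b \in B -> code b + 2 ^ l < n -> beta f (wof b) (y l) = 1%R.
Proof.
move=> Zf Hfree; elim=> // n IH b l bB; rewrite ltnS => le_n.
have [Fbl|] := boolP ((b, l) \in free); first exact: Hfree Fbl.
rewrite in_setD in_setX in_setT /= bB !andbT negbK inE /= bB /= => /andP[lb /eqP pick_l].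
(* The inversion ambiguity of [wof] does not affect triviality of the pairing. *)
have betaE i j k : i != j -> beta f (wof [set i; j]) (y k) = 1%R <->
    beta f [~ y i, y j] (y k) = 1%R.
  move=> ij; case: (wofE ij) => -> //.
  have Dw := wofD [set i; j]; have Gw := GD Dw.
  have e : (beta f (wof [set i; j])^-1 (y k) * beta f (wof [set i; j]) (y k))%R = 1%R.
    rewrite -(betaMl Zf) ?groupV ?mulVg ?(betaV f (Gy k)) //.
    - by rewrite (beta1r Zf) ?invr1.
    - by apply: commute_sym; apply: cZ; rewrite ?groupV.
    - by apply: commute_sym; apply: cZ.
  by split=> E; move: e; rewrite E ?mulr1 ?mul1r.
pose T := l |: b.
have b2 : #|b| = 2 by move: bB; rewrite inE => /andP[/eqP].
have T3 : #|T| = 3 by rewrite cardsU1 lb b2.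
have codeT : code T = code b + 2 ^ l by rewrite (codeD1 (setU11 l b)) setU1K // addnC.
have other l' : l' \in T -> l' != l -> beta f (wof (T :\ l')) (y l') = 1%R.
  move=> Tl' l'l; have codeT' := codeD1 Tl'.
  have e2 : #|T :\ l'| == 2 by have := cardsD1 l' T; rewrite Tl' T3 add1n => -[<-].
  (* A face in [B] other than the one picked for [T] is free. A face outside [B] is spanned by basis
     pairs of smaller code, and adding [2 ^ l'] keeps them below [code T], where the induction
     applies. *)
  have [eB|eB] := boolP (T :\ l' \in B).
    apply: (Hfree (T :\ l', l')); rewrite in_setD in_setX in_setT inE /= eB setD11 setD1K //=.
    rewrite ?andbT -/T -[T]/(l |: b) pick_l; apply/eqP=> -[/esym e].
    by rewrite e eqxx in l'l.
  have Ve : wof (T :\ l') \in VB (code (T :\ l')).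
    by apply: (subsetP (V_VB _)); move: eB; rewrite inE e2 negbK.
  move: Ve; apply: (@mult_hom_gen _ G^`(1)%G _ (fun w => beta f w (y l'))).
  - by move=> w Dw; apply: (beta_neq0 Zf) => //; apply: GD.
  - move=> v w Dv Dw; apply: (betaMl Zf) => //; try exact: GD.
    by apply: commute_sym; apply: cZ.
    by apply: commute_sym; apply: cZ.
  - by apply/subsetP=> _ /imsetP[e _ ->]; apply: wofD.
  move=> _ /imsetP[e He ->]; move: He; rewrite inE => /andP[eB' lt_e].
  by apply: IH => //; apply: leq_trans le_n; rewrite -codeT codeT' addnC ltn_add2l.
have /cards2P[i [j [ij eb]]] : #|b| == 2 by rewrite b2.
have [il jl] : i != l /\ j != l.
  by move: lb; rewrite eb !inE negb_or ![l == _]eq_sym => /andP[].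
have Ti : T :\ i = [set j; l].
  apply/setP=> k; rewrite /T eb !inE; case: (eqVneq k i) => [->|_] /=.
    by rewrite (negPf ij) (negPf il).
  by rewrite orbC.
have Tj : T :\ j = [set i; l].
  apply/setP=> k; rewrite /T eb !inE; case: (eqVneq k j) => [->|_] /=.
    by rewrite eq_sym (negPf ij) (negPf jl).
  by rewrite orbF orbC.
have := beta_jacobi Zf class2 (Gy i) (Gy j) (Gy l).
have -> : beta f [~ y j, y l] (y i) = 1%R.
  by apply/betaE => //; rewrite -Ti; apply: other => //; rewrite /T eb !inE eqxx ?orbT.
have -> : beta f [~ y i, y l] (y j) = 1%R.
  by apply/betaE => //; rewrite -Tj; apply: other => //; rewrite /T eb !inE eqxx ?orbT.
by rewrite mulr1 eb => /betaE->.
Qed.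

Let free_sep f : mult_cocycle G f ->
  (forall u, u \in free -> beta f (wof u.1) (y u.2) = 1%R) ->
  forall w x, w \in G^`(1) -> x \in G -> beta f w x = 1%R.
Proof.
move=> Zf Hfree w x Dw; have Gw := GD Dw.
rewrite -{1}defG; apply: (@mult_hom_gen _ G _ (beta f w)).
- by move=> z Gz; apply: (beta_neq0 Zf).
- by move=> u v Gu Gv; apply: (betaMr Zf) => //; apply: cZ.
- by rewrite subUset center_sub andbT; apply/subsetP=> _ /imsetP[i _ ->].
move=> z /setUP[/imsetP[l _ ->]|Zz]; last first.
  have Gz := subsetP (center_sub G) _ Zz.
  by rewrite (betaV f Gz) // (beta_center_der1 Zf) ?invr1.
have := Dw; rewrite der1_VB; apply: (@mult_hom_gen _ G^`(1)%G _ (fun w => beta f w (y l))).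
- by move=> v Dv; apply: (beta_neq0 Zf) => //; apply: GD.
- move=> u v Du Dv; apply: (betaMl Zf) => //; try exact: GD.
  by apply: commute_sym; apply: cZ.
  by apply: commute_sym; apply: cZ.
- by apply/subsetP=> _ /imsetP[e _ ->]; apply: wofD.
move=> _ /imsetP[e He ->]; move: He; rewrite inE => /andP[eB _].
exact: (elimination Zf Hfree eB (ltnSn _)).
Qed.

(** Of the [#|B| * D] values, one is saved for each triple with a face in [B]. The other triples are
    triangles of the graph [E] of pairs outside [B]. *)
Let card_free r t : t < r -> 'C(D, 2) <= #|B| + 'C(r, 2) + t ->
  #|free| + 'C(D, 3) <= #|B| * D + 'C(r, 3) + 'C(t, 2).
Proof.
move=> tr leB; pose P2 := [set e : {set 'I_D} | #|e| == 2].
have sBP : B \subset P2 by apply/subsetP=> b; rewrite !inE => /andP[].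
have cP2 : #|P2| = 'C(D, 2) by rewrite card_draws card_ord.
pose E := P2 :\: B.
have cE : #|E| + #|B| = 'C(D, 2).
  rewrite -cP2 cardsD (setIidPr sBP) subnK //; exact: subset_leq_card.
have E2 e : e \in E -> #|e| = 2 by rewrite !inE => /andP[_ /eqP].
have tri : #|triangles E| <= 'C(r, 3) + 'C(t, 2) by apply: card_triangles => //; rewrite -(leq_add2r #|B|) cE addnC addnA.
have sNF : NF \subset setX B [set: 'I_D].
  by apply/subsetP=> -[b l]; rewrite in_setX in_setT inE => /and3P[/= ->].
have cF : (#|free| + #|NF| = #|B| * D)%N.
  have <- : #|setX B [set: 'I_D]| = (#|B| * D)%N by rewrite cardsX cardsT card_ord.
  rewrite cardsD (setIidPr sNF) subnK //.
  exact: subset_leq_card.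
(* Every triple with a face in [B] is [u.2 |: u.1] for some [u] in [NF]. *)
have cT : 'C(D, 3) <= #|triangles E| + #|NF|.
  have <- : #|[set T : {set 'I_D} | #|T| == 3]| = 'C(D, 3) by rewrite card_draws card_ord.
  set S3 := [set T : {set 'I_D} | _]; rewrite -(cardsID (triangles E) S3).
  apply: leq_add; first exact: subset_leq_card (subsetIr _ _).
  apply: leq_trans (leq_imset_card (fun u : {set 'I_D} * 'I_D => u.2 |: u.1) NF).
  apply: subset_leq_card; apply/subsetP=> T; rewrite in_setD !inE => /andP[nT T3].
  case: (pickP [pred l in T | T :\ l \in B]) => [l /andP[/= Tl TB]|none]; last first.
    case/negP: nT; rewrite T3 /=; apply/forallP=> l; apply/implyP=> Tl.
    have := none l; rewrite /= Tl /= => nB; rewrite in_setD nB inE.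
    by have := cardsD1 l T; rewrite Tl (eqP T3) add1n => -[<-].
  case e: [pick l in T | T :\ l \in B] => [k|]; last first.
    by move: e; case: pickP => // /(_ l); rewrite /= Tl TB.
  have [Tk TkB] : k \in T /\ T :\ k \in B.
    by move: e; case: pickP => // k' /andP[? ?] [<-].
  apply/imsetP; exists (T :\ k, k); last by rewrite /= setD1K.
  by rewrite inE /= TkB setD11 setD1K //= e.
by rewrite -cF -!addnA leq_add2l (leq_trans cT) // addnC leq_add2l.
Qed.

(* [s] is the size of a basis of G' among the commutators of pairs, [k] the
   number of values left free by the Jacobi relations. *)
Lemma class2_step c d : mult_bound (G / G^`(1)) c d ->
  exists s k : nat, exists X : {set gT},
  [/\ <<X>> = G^`(1) /\ #|X| <= s, p ^ s <= #|G^`(1)|,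
     mult_bound G (#|G^`(1)| * c) (p ^ k * d) &
     forall r t, t < r -> 'C(D, 2) <= s + 'C(r, 2) + t ->
       k + 'C(D, 3) <= s * D + 'C(r, 3) + 'C(t, 2)].
Proof.
move=> bQ; have BT : [set b in B | code b < 2 ^ D] = B.
  by apply/setP=> b; rewrite memB codeB andbT.
exists #|B|, #|free|, [set wof b | b in B]; split; last exact: card_free.
- split; last exact: leq_imset_card.
  by rewrite der1_VB /VBT /VB BT.
- by have := card_B (2 ^ D); rewrite BT => /leq_trans-> //; apply/subset_leq_card/sVD.
pose T := [seq (wof u.1, y u.2, p) | u <- enum free].
have -> : (p ^ #|free| = \prod_(t <- T) t.2)%N.
  by rewrite big_map big_enum prod_nat_const.
apply: central_step => //.
  move=> _ /mapP[u _ ->]; split; rewrite //= ?prime_gt0 // => f Zf.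
  by apply: (beta_test Zf); rewrite ?expG' //; [apply: GD | apply: cZ].
move=> f Zf Hf n x; apply: free_sep Zf _ _ _ => u Fu.
by apply: (Hf (wof u.1, y u.2, p)); apply: map_f; rewrite mem_enum.
Qed.

End ClassTwo.

(** * Groups of prime power order *)

Lemma quotient_gens (gT : finGroupType) (G N : {group gT}) (B : {set coset_of N}) :
  N <| G -> <<B>> = G / N ->
  let X := [set repr b | b : coset_of N in B] in X \subset G /\ X <*> N = G.
Proof.
move=> nNG defB X.
have sBG : B \subset G / N by rewrite -defB subset_gen.
have sXG : X \subset G.
  apply/subsetP=> _ /imsetP[b Bb ->]; rewrite -(quotientGK nNG).
  apply/morphpreP; split; first exact: repr_coset_norm.
  by rewrite /= coset_reprK (subsetP sBG).
split=> //; apply/eqP; rewrite eqEsubset join_subG sXG normal_sub //=.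
rewrite -(quotientSGK (normal_norm nNG)) ?joing_subr // -defB gen_subG.
apply/subsetP=> b Bb; rewrite -(coset_reprK b).
by apply: mem_quotient; apply: (subsetP (joing_subl _ _)); apply: imset_f.
Qed.

Lemma grank_quotient_lcn3 p (gT : finGroupType) (P : {group gT}) s
    (X : {set coset_of ('L_3(P) <*> 'Phi('L_2(P)))}) :
  p.-group P -> <<X>> = 'L_2(P) / ('L_3(P) <*> 'Phi('L_2(P))) -> #|X| <= s ->
  gen_rank ('L_2(P) / 'L_3(P)) <= s.
Proof.
move=> pP; set L := 'L_3(P) <*> _ => defX Xs.
have nL3 : 'L_3(P) <| 'L_2(P) := lcn_normalS 2 P.
have nL : L <| 'L_2(P) by rewrite normalY ?Phi_normal.
have [sYL defY] := quotient_gens nL defX.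
set Y := [set repr b | b : coset_of L in X] in sYL defY.
have defL2 : <<Y <*> 'L_3(P)>> = 'L_2(P).
  by apply: Phi_nongen; rewrite joingC -joingA.
have -> : 'L_2(P) / 'L_3(P) = <<Y / 'L_3(P)>>.
  apply/eqP; rewrite eqEsubset gen_subG quotientS // andbT -{1}defL2 genGid.
  rewrite quotientY ?normG ?(subset_trans sYL (normal_norm nL3)) //.
  by rewrite trivg_quotient join_subG subset_gen sub1G.
apply: (leq_trans (grank_min (Y / 'L_3(P)))); apply: (leq_trans (leq_quotient _ _)).
by apply: leq_trans Xs; apply: leq_imset_card.
Qed.

Lemma pgroup_mult_bound p (gT : finGroupType) (P : {group gT}) r t :
  prime p -> p.-group P ->
  'C(gen_rank (P / 'Z(P)), 2) = gen_rank ('L_2(P) / 'L_3(P)) + ('C(r, 2) + t) ->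
  t < r ->
  let del := gen_rank (P / 'Z(P)) in
  let k := logn p #|'L_2(P)| in
  exists q K, [/\ mult_bound P (p ^ k) (p ^ K * q),
    q ^ 2 <= (p ^ (logn p #|P| - k)) ^ (gen_rank P).-1,
    k <= logn p #|P| &
    K + 'C(del, 3) <= k * del + 'C(r, 3) + 'C(t, 2)].
Proof.
move=> p_pr pP Erank tr del k.
have nZ : 'Z(P) <| P := center_normal P.
have [B defB cardB] := grank_witness (P / 'Z(P))%G.
have [sXP defP] := quotient_gens nZ defB; set X := [set repr b | b : coset_of _ in B] in sXP defP.
(* The smallest choice that makes [P / L] of class at most two with derived subgroup of exponent
   dividing [p]. *)
pose L := ('L_3(P) <*> 'Phi('L_2(P)))%G.
have nLP : L <| P.
  by rewrite /= normalY ?lcn_normal // (char_normal_trans (Phi_char _)) ?lcn_normal.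
have sLD : L \subset P^`(1).
  by rewrite /= join_subG (lcn_subS 2 P) (Phi_sub 'L_2(P)).
have nPL := normal_norm nLP.
have sDP : P^`(1) \subset P := der_sub 1 P.
pose H := (P / L)%G.
have derH : H^`(1) = P^`(1) / L by rewrite -quotient_der.
have class2 : H^`(1) \subset 'Z(H).
  rewrite subsetI der_sub derH quotient_cents2r //.
  exact: subset_trans (joing_subl 'L_3(P) _).
have expH w : w \in H^`(1) -> w ^+ p = 1.
  rewrite derH => /morphimP[x nx Dx ->]; rewrite -morphX //; apply: coset_id.
  apply: (subsetP (joing_subr 'L_3(P) _)); rewrite (Phi_joing (pgroupS sDP pP)).
  apply: (subsetP (joing_subr _ _)); rewrite -(expn1 p); apply: Mho_p_elt => //.
  exact: mem_p_elt (pgroupS sDP pP) Dx.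
have pH : p.-group H := quotient_pgroup L pP.
pose y (i : 'I_#|B|) := coset L (repr (enum_val i)).
have defH : [set y i | i : 'I_#|B|] <*> 'Z(H) = H.
  apply/eqP; rewrite eqEsubset join_subG center_sub andbT; apply/andP; split.
    apply/subsetP=> _ /imsetP[i _ ->]; apply: mem_quotient.
    by apply: (subsetP sXP); apply: imset_f; apply: enum_valP.
  have eH : gval H = (X <*> 'Z(P)) / L by rewrite defP.
  rewrite {1}eH quotientY ?(subset_trans sXP) ?(subset_trans (center_sub P)) //.
  rewrite genS // setUSS ?morphim_center //.
  apply/subsetP=> _ /morphimP[x _ /imsetP[b Bb ->] ->].
  by apply/imsetP; exists (enum_rank_in Bb b); rewrite // /y enum_rankK_in.
have cHH : abelian (H / H^`(1)) by exact: der_abelian 0 H.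
have [q bq leq_q] := mult_bound_abelian cHH.
have [s [fr [Xw [[defW cXw] le_s bH comb]]]] := class2_step p_pr pH class2 expH defH bq.
have bP := mult_bound_chain p_pr pP nLP sLD defP bH.
have pL : p.-group L := pgroupS (normal_sub nLP) pP.
have cardL : #|L| = (p ^ logn p #|L|)%N by rewrite -p_part part_pnat_id.
have pD : p.-group 'L_2(P) := pgroupS sDP pP.
have cardD : #|'L_2(P)| = (p ^ k)%N by rewrite -p_part part_pnat_id.
have cardDL : #|'L_2(P)| = (#|L| * #|H^`(1)|)%N.
  by rewrite derH card_quotient ?(subset_trans sDP) // Lagrange.
have pH' : p.-group H^`(1) := pgroupS (der_sub 1 H) pH.
have cardH' : #|H^`(1)| = (p ^ logn p #|H^`(1)|)%N by rewrite -p_part part_pnat_id.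
have ek : k = (logn p #|L| + logn p #|H^`(1)|)%N by rewrite /k cardDL lognM ?cardG_gt0.
have sw : s <= logn p #|H^`(1)|.
  by rewrite -(leq_exp2l _ _ (prime_gt1 p_pr)) -cardH'.
(* This turns the equation defining [r] and [t] into the inequality required by [comb]. *)
have le_rank : gen_rank ('L_2(P) / 'L_3(P)) <= s.
  by apply: (grank_quotient_lcn3 pP _ cXw); rewrite defW derH.
have XB : #|X| <= gen_rank (P / 'Z(P)) by rewrite -cardB leq_imset_card.
have le_k : k <= logn p #|P| by rewrite dvdn_leq_log ?cardG_gt0 ?cardSg.
have eP : #|P| = (p ^ logn p #|P|)%N by rewrite -p_part part_pnat_id.
have p0 := prime_gt0 p_pr.
(* The chain through [L] costs at most a factor [p ^ del] for each of its [logn p #|L|] steps; the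
   class-two step adds [fr]. *)
exists q, (logn p #|L| * gen_rank (P / 'Z(P)) + fr)%N; split=> //.
- move: bP; rewrite muln1 -cardDL cardD; apply: mult_bound_leq.
  rewrite mulnA leq_mul2r; apply/orP; right.
  by rewrite expnD expnM -cardL leq_mul2r leq_pexp2l ?cardG_gt0 ?orbT.
- have cardHH : #|H / H^`(1)| = (p ^ (logn p #|P| - k))%N.
    have c1 : (#|H / H^`(1)| * #|H^`(1)| = #|H|)%N.
      by rewrite card_quotient ?der_norm // mulnC Lagrange ?der_sub.
    have c2 : (#|H| * #|L| = #|P|)%N.
      by rewrite card_quotient // mulnC Lagrange ?normal_sub.
    have e : (#|H / H^`(1)| * p ^ k = p ^ logn p #|P|)%N.
      by rewrite -cardD cardDL mulnCA c1 mulnC c2 -eP.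
    by apply/eqP; rewrite expnB // -e mulnK // expn_gt0 p0.
  rewrite -cardHH; apply: leq_trans leq_q _; rewrite leq_pexp2l ?cardG_gt0 //.
  rewrite -!subn1 leq_sub2r //.
  rewrite -(grank_abelian cHH) (leq_trans (quotient_grank _)) ?der_norm //.
  exact: quotient_grank.
have := comb r t tr; rewrite cardB => /(_ _) le_fr.
have {le_fr} : fr + 'C(gen_rank (P / 'Z(P)), 3) <=
    s * gen_rank (P / 'Z(P)) + 'C(r, 3) + 'C(t, 2).
  by apply: le_fr; rewrite Erank addnA -!addnA leq_add2r.
move=> le_fr; rewrite ek mulnDl -!addnA leq_add2l.
by apply: (leq_trans le_fr); rewrite -addnA leq_add2r leq_mul2r sw orbT.
Qed.

(** Squaring clears the halves in the exponent, and integer powers of a rational allow subtraction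
    in it. Nontriviality of [P] makes [(gen_rank P).-1] a true difference. *)
Lemma pgroup_mult_bound_rat p (gT : finGroupType) (P : {group gT}) r t :
  prime p -> p.-group P -> P != 1%G ->
  'C(gen_rank (P / 'Z(P)), 2) = gen_rank ('L_2(P) / 'L_3(P)) + ('C(r, 2) + t) ->
  t < r ->
  exists m, mult_bound P 1 m /\
    ((m%:R : rat) ^+ 2 <=
        let d := (gen_rank P)%:Z in
        let delta := (gen_rank (P / 'Z(P)))%:Z in
        let np := (logn p #|P|)%:Z in
        let k := (logn p #|'L_2(P)|)%:Z in
        (p%:R : rat) ^ ((d - 1) * (np + k) - 2 * k * (d - delta)
                         - 2 * ('C(gen_rank (P / 'Z(P)), 3))%:Z
                         + 2 * ('C(r, 3))%:Z + 2 * ('C(t, 2))%:Z))%R.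
Proof.
move=> p_pr pP ntP Erank tr.
have [q [K [bP leq_q le_k leK]]] := pgroup_mult_bound p_pr pP Erank tr.
have m_gt0 : 0 < gen_rank P.
  rewrite lt0n; apply: contra ntP => /eqP m0; have [B defB cB] := grank_witness P.
  by apply/eqP/val_inj; rewrite /= -defB (cards0_eq (etrans cB m0)) gen0.
move: bP leq_q le_k leK; set k := logn p #|'L_2(P)|; set n := logn p #|P|.
set del := gen_rank (P / 'Z(P)); set d := gen_rank P in m_gt0 *.
move=> bP leq_q le_k leK; have p0 := prime_gt0 p_pr.
have pk0 : 0 < p ^ k by rewrite expn_gt0 p0.
exists ((p ^ K * q) %/ p ^ k); split.
  by move=> I A h /bP le; rewrite muln1 leq_divRL.
set m := _ %/ _.
have le_m : m ^ 2 * p ^ (2 * k) <= p ^ (2 * K + (n - k) * d.-1).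
  rewrite [(2 * k)%N]mulnC expnM -expnMn.
  apply: (@leq_trans ((p ^ K * q) ^ 2)); first by rewrite leq_exp2r // leq_trunc_div.
  rewrite expnMn expnD -expnM [(K * 2)%N]mulnC leq_mul2l; apply/orP; right.
  by rewrite expnM.
have p1R : (1 <= p%:R :> rat)%R by rewrite ler1n.
have p0R : (0 < p%:R :> rat)%R by rewrite ltr0n.
move: le_m; rewrite -(ler_nat rat) natrM !natrX => le_m.
apply: (@Order.POrderTheory.le_trans _ _ ((p%:R : rat) ^ ((2 * K + (n - k) * d.-1)%N%:Z - (2 * k)%N%:Z))%R).
  by rewrite expfzDr ?lt0r_neq0 // -invr_expz ler_pdivlMr ?exprz_gt0.
apply: ler_weXz2l => //.
(* With [n = k + n'] and [d = d' + 1], the terms in [d'] cancel and twice [leK] remains. *)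
move: leK le_k m_gt0; rewrite -/del; move: 'C(del, 3) 'C(r, 3) 'C(t, 2) => c3 cr ct.
clear; move: del k n d K => del k n d K leK /subnKC <- /prednK <-.
rewrite addKn /= in leK *.
move: (n - k) (d.-1) => n' d'.
lia.
Qed.

(* The bound is stated in squared form: |M(G)|^2 <= prod_p p^(2 e_p), with
   2 e_p = (d_p-1)(n_p+k_p) - 2 k_p (d_p-delta_p) - 2 C(delta_p,3)
           + 2 C(r_p,3) + 2 C(t_p,2)  (an integer). *)
Theorem theorem3p5 (gT : finGroupType) (G : {group gT})
    (S : nat -> {group gT}) (r t : nat -> nat) :
  (forall p, p \in primes #|G| -> S p \in 'Syl_p(G)) ->
  (forall p, p \in primes #|G| ->
     (('C(gen_rank (S p / 'Z(S p))%G, 2))%:Z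
        - (gen_rank ('L_2(S p) / 'L_3(S p))%G)%:Z
      = ('C(r p, 2) + t p)%:Z)%R /\ t p < r p) ->
  exists m : nat, schur_mult_le G m /\
    ((m%:R : rat) ^+ 2 <=
     \prod_(p <- primes #|G|)
        let d := (gen_rank (S p))%:Z in
        let delta := (gen_rank (S p / 'Z(S p))%G)%:Z in
        let np := (logn p #|G|)%:Z in
        let k := (logn p #|'L_2(S p)|)%:Z in
        (p%:R : rat) ^ ((d - 1) * (np + k) - 2 * k * (d - delta)
                         - 2 * ('C(gen_rank (S p / 'Z(S p))%G, 3))%:Z
                         + 2 * ('C(r p, 3))%:Z + 2 * ('C(t p, 2))%:Z))%R.
Proof.
move=> sylS rtS.
(* Indexing by ordinals makes finite choice available; prime divisors are at most [#|G|], so [inord]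
   recovers them. Elsewhere 0 is a dummy value. *)
have bS (i : 'I_#|G|.+1) : exists m, (i : nat) \in primes #|G| -> mult_bound (S i) 1 m /\
    ((m%:R : rat) ^+ 2 <=
        let d := (gen_rank (S i))%:Z in
        let delta := (gen_rank (S i / 'Z(S i))%G)%:Z in
        let np := (logn i #|G|)%:Z in
        let k := (logn i #|'L_2(S i)|)%:Z in
        (i%:R : rat) ^ ((d - 1) * (np + k) - 2 * k * (d - delta)
                         - 2 * ('C(gen_rank (S i / 'Z(S i))%G, 3))%:Z
                         + 2 * ('C(r i, 3))%:Z + 2 * ('C(t i, 2))%:Z))%R.
  have [Pi|] := boolP ((i : nat) \in primes #|G|); last by exists 0.
  have := sylS _ Pi; rewrite inE => sylSi.
  have pS := pHall_pgroup sylSi.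
  have := Pi; rewrite mem_primes => /and3P[pr_i _ i_dv].
  have lognS : logn i #|S i| = logn i #|G| by rewrite (card_Hall sylSi) logn_part.
  have ntS : S i != 1%G.
    apply/eqP=> S1; move: lognS; rewrite S1 cards1 logn1 => /esym/eqP.
    by rewrite eqn0Ngt logn_gt0 Pi.
  have [rk tr] := rtS _ Pi.
  have rk' : 'C(gen_rank (S i / 'Z(S i)), 2) =
      gen_rank ('L_2(S i) / 'L_3(S i)) + ('C(r i, 2) + t i).
    by apply/eqP; rewrite -eqz_nat PoszD -rk addrC subrK.
  have [m [bm le_m]] := pgroup_mult_bound_rat pr_i pS ntS rk' tr.
  by exists m => _; rewrite -lognS.
have {bS} [mm Hmm] := fin_all_exists bS.
pose m p := mm (inord p).
have inordP p : p \in primes #|G| -> (inord p : 'I_#|G|.+1) = p :> nat.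
  by rewrite mem_primes => /and3P[_ G0 p_dv]; rewrite inordK // ltnS dvdn_leq.
have mP p (Pp : p \in primes #|G|) := Hmm (inord p).
have [|m0 le_m0 bG] := max_indep (mult_bound_sylow (m := m) sylS _).
  by move=> p Pp; have := mP p Pp; rewrite inordP // => /(_ Pp)[].
exists m0; split=> //.
apply: (@Order.POrderTheory.le_trans _ _ ((\prod_(p <- primes #|G|) m p)%N%:R ^+ 2)%R).
  by rewrite lerXn2r ?nnegrE ?ler0n // ler_nat.
rewrite natr_prod -prodrXl big_seq [X in (_ <= X)%R]big_seq.
apply: ler_prod => p Pp; rewrite exprn_ge0 ?ler0n //=.
by have := mP p Pp; rewrite inordP // => /(_ Pp)[].
Qed.
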